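(* Suppose that $H$ is a separable real or complex Hilbert space, and that $A$ is a densely defined symmetric operator on $H$. Then there exist a compact metric space $\hat\Omega$, a probability measure $\hat\mu$ on $\mathrm{Borel}(\hat\Omega)$, a linear isometry $\hat U:H\to L_2(\hat\Omega,\hat\mu)$ and a square-integrable function $\hat m:\hat\Omega\to\mathbb{R}$, generating the multiplication operator $\hat T$ on $L_2(\hat\Omega,\hat\mu)$, such that $\hat U\circ A\subset \hat T\circ\hat U$.
   Context: $A$ symmetric and densely defined means: $A$ is a linear operator with dense domain $\mathrm{dom}(A)\subset H$ and $\langle Ax,y\rangle=\langle x,Ay\rangle$ for all $x,y\in\mathrm{dom}(A)$ ($A$ may be unbounded and need not be closed). $L_2(\hat\Omega,\hat\mu)$ is taken over the same scalar field as $H$. The multiplication operator $\hat T$ generated by $\hat m$ has domain $\{g\in L_2(\hat\Omega,\hat\mu): \hat m g\in L_2(\hat\Omega,\hat\mu)\}$ and is given by $\hat T g=\hat m g$. The inclusion $\hat U\circ A\subset\hat T\circ\hat U$ means inclusion of graphs: for every $x\in\mathrm{dom}(A)$, $\hat U(x)\in\mathrm{dom}(\hat T)$ and $\hat U(Ax)=\hat m\cdot\hat U(x)$. *)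

(* Defs.v *)
From HB Require Import structures.
From mathcomp Require Import all_boot all_order all_algebra.
From mathcomp Require Import all_classical all_reals all_analysis.
From mathcomp Require Import measurable_realfun complex.

Set Implicit Arguments.
Unset Strict Implicit.
Unset Printing Implicit Defensive.

Import Order.TTheory GRing.Theory Num.Theory.
Import numFieldNormedType.Exports.

Local Open Scope classical_set_scope.
Local Open Scope ring_scope.

Variant scalar_kind := RealScalars | ComplexScalars.

Definition scalars (R : realType) (k : scalar_kind) : numFieldType :=
  match k with RealScalars => R | ComplexScalars => R[i] end.

Section scalars.
Variables (R : realType) (k : scalar_kind).
Local Notation K := (scalars R k).

Definition sconj : K -> K :=
  match k return scalars R k -> scalars R k with
  | RealScalars => idfun
  | ComplexScalars => Num.conj
  end.

Definition sofR : R -> K :=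
  match k return R -> scalars R k with
  | RealScalars => idfun
  | ComplexScalars => fun x => Complex x 0
  end.

Definition sre : K -> R :=
  match k return scalars R k -> R with
  | RealScalars => idfun
  | ComplexScalars => @complex.Re R
  end.

Definition sim : K -> R :=
  match k return scalars R k -> R with
  | RealScalars => fun=> 0
  | ComplexScalars => @complex.Im R
  end.

(* The norm of K takes its values in K; [sabs] is the same number seen in R. *)
Definition sabs (x : K) : R := sre `|x|.

End scalars.
Arguments sconj {R k} _.
Arguments sofR {R} k _.
Arguments sre {R k} _.
Arguments sim {R k} _.
Arguments sabs {R k} _.

Section scalars_lemmas.
Variables (R : realType) (k : scalar_kind).
Local Notation K := (scalars R k).
Implicit Types (x y : K) (a b : R).

Lemma sofR_sabs x : sofR k (sabs x) = `|x|.
Proof.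
by case: k x => // x; rewrite /sabs /sofR /sre normc_def.
Qed.

Lemma sofR_inj : injective (@sofR R k).
Proof. by case: k => // a b []. Qed.

Lemma sofR0 : sofR k (0 : R) = 0. Proof. by case: k. Qed.

Lemma sofRD a b : sofR k (a + b) = sofR k a + sofR k b.
Proof. by case: k => //=; rewrite /GRing.add/= addr0. Qed.

Lemma sofRM a b : sofR k (a * b) = sofR k a * sofR k b.
Proof.
by case: k => //=; rewrite /GRing.mul/= !(mulr0, mul0r) subr0 addr0.
Qed.

Lemma ler_sofR a b : (sofR k a <= sofR k b) = (a <= b).
Proof. by case: k => //=; rewrite lecR. Qed.

Lemma sofR_norm a : `|sofR k a| = sofR k `|a|.
Proof. by case: k => //=; rewrite normc_def /= expr0n addr0 sqrtr_sqr. Qed.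

Lemma sabs_ge0 x : 0 <= sabs x.
Proof. by rewrite -ler_sofR sofR_sabs sofR0. Qed.

Lemma sabsD x y : sabs (x + y) <= sabs x + sabs y.
Proof. by rewrite -ler_sofR sofRD !sofR_sabs ler_normD. Qed.

Lemma sabsM x y : sabs (x * y) = sabs x * sabs y.
Proof. by apply: sofR_inj; rewrite sofRM !sofR_sabs normrM. Qed.

Lemma sabs0_eq0 x : sabs x = 0 -> x = 0.
Proof. by move=> x0; apply/normr0_eq0; rewrite -sofR_sabs x0 sofR0. Qed.

Lemma sabs_sqrt x : sabs x = Num.sqrt (sre x ^+ 2 + sim x ^+ 2).
Proof.
by case: k x => x; rewrite /sabs /sre /sim ?normc_def//= expr0n addr0 sqrtr_sqr.
Qed.

Lemma sreD x y : sre (x + y) = sre x + sre y.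
Proof. by case: k x y => // -[a b] [c d]. Qed.

Lemma simD x y : sim (x + y) = sim x + sim y.
Proof. by case: k x y => [x y|[a b] [c d]] //=; rewrite addr0. Qed.

Lemma sreM x y : sre (x * y) = sre x * sre y - sim x * sim y.
Proof. by case: k x y => [x y|[a b] [c d]] //=; rewrite mulr0 subr0. Qed.

Lemma simM x y : sim (x * y) = sre x * sim y + sim x * sre y.
Proof. by case: k x y => [x y|[a b] [c d]] //=; rewrite mulr0 mul0r addr0. Qed.

Lemma sre_sofR a : sre (sofR k a) = a. Proof. by case: k. Qed.

Lemma sim_sofR a : sim (sofR k a) = 0. Proof. by case: k. Qed.

End scalars_lemmas.


Section Lnorm_lemmas.
Context (R : realType) (d : measure_display) (T : measurableType d).
Variable mu : {measure set T -> \bar R}.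
Local Notation N2 f := ('N[mu]_(2%:E) [EFin \o f%R])%E.

Let measurable_poweR2 (f : T -> R) : measurable_fun setT f ->
  measurable_fun setT ((fun x => `|(EFin \o f) x| `^ 2)%E : T -> \bar R).
Proof.
move=> mf; apply/measurable_EFinP.
apply/(@measurableT_comp _ _ _ _ _ _ (fun x : R => x `^ 2)%R) => //.
exact/measurableT_comp.
Qed.

Lemma le_Lnorm2 (f g : T -> R) :
  measurable_fun setT f -> measurable_fun setT g ->
  (forall x, 0 <= f x <= g x) -> (N2 f <= N2 g)%E.
Proof.
move=> mf mg fg; rewrite unlock /Lnorm.
apply: gt0_ler_poweR; rewrite ?invr_ge0//.
- by rewrite in_itv/= leey integral_ge0// => x _; exact: poweR_ge0.
- by rewrite in_itv/= leey integral_ge0// => x _; exact: poweR_ge0.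
apply: ge0_le_integral => //; try exact: measurable_poweR2.
  by move=> x _; exact: poweR_ge0.
move=> x _ /=; have /andP[f0 fgx] := fg x; rewrite lee_fin.
have g0 := le_trans f0 fgx.
by rewrite ge0_ler_powR ?nnegrE//; rewrite !ger0_norm.
Qed.

Lemma ae_eq_Lnorm2 (f g : T -> R) :
  measurable_fun setT f -> measurable_fun setT g ->
  f = g %[ae mu] -> N2 f = N2 g.
Proof.
move=> mf mg fg; rewrite unlock /Lnorm; congr (_ `^ _)%E.
apply: ae_eq_integral => //; try exact: measurable_poweR2.
by apply: filterS fg => x /= /[apply] ->.
Qed.

Lemma Lnorm2Z (f : T -> R) (c : R) : f \in Lfun mu 2%:E ->
  N2 (fun x => c * f x) = (`|c|%:E * N2 f)%E.
Proof. by move=> Lf; rewrite -(LnormZ (Lfun_Sub (lee1n 2) Lf)). Qed.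

End Lnorm_lemmas.

Section L2.
Context (R : realType) (k : scalar_kind).
Context (d : measure_display) (T : measurableType d).
Variable mu : {measure set T -> \bar R}.
Local Notation K := (scalars R k).
Local Notation N2 f := ('N[mu]_(2%:E) [EFin \o (sabs \o f%R)])%E.

(* Borel measurability of a K-valued function, through its real and imaginary
   parts. *)
Definition measurable_sfun (f : T -> K) :=
  measurable_fun setT (sre \o f) /\ measurable_fun setT (sim \o f).

Definition L2fun : {pred T -> K^o} :=
  mem [set f | measurable_sfun f /\ finite_norm mu 2%:E (sabs \o f)].

Lemma measurable_sabs (f : T -> K) :
  measurable_sfun f -> measurable_fun setT (sabs \o f).
Proof.
move=> [mre mim].
rewrite (_ : _ \o _ = Num.sqrt \o (fun x => sre (f x) ^+ 2 + sim (f x) ^+ 2)); last first.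
  by apply/funext => x /=; rewrite sabs_sqrt.
apply: (@measurableT_comp _ _ _ _ _ _ (@Num.sqrt R)).
  by apply: continuous_measurable_fun; exact: sqrt_continuous.
by apply: measurable_funD; apply: measurable_funX.
Qed.

Lemma measurable_sfunD (f g : T -> K) : measurable_sfun f ->
  measurable_sfun g -> measurable_sfun (fun x => f x + g x).
Proof.
move=> [fr fi] [gr gi]; split.
  rewrite (_ : _ \o _ = (sre \o f) \+ (sre \o g)); first exact: measurable_funD.
  by apply/funext => x /=; rewrite sreD.
rewrite (_ : _ \o _ = (sim \o f) \+ (sim \o g)); first exact: measurable_funD.
by apply/funext => x /=; rewrite simD.
Qed.

Lemma measurable_sfunM (f g : T -> K) : measurable_sfun f ->
  measurable_sfun g -> measurable_sfun (fun x => f x * g x).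
Proof.
move=> [fr fi] [gr gi]; split.
  rewrite (_ : _ \o _ =
    ((sre \o f) \* (sre \o g)) \- ((sim \o f) \* (sim \o g))).
    by apply: measurable_funB; exact: measurable_funM.
  by apply/funext => x /=; rewrite sreM.
rewrite (_ : _ \o _ =
  ((sre \o f) \* (sim \o g)) \+ ((sim \o f) \* (sre \o g))).
  by apply: measurable_funD; exact: measurable_funM.
by apply/funext => x /=; rewrite simM.
Qed.

Lemma measurable_sfun_cst (c : K) : measurable_sfun (cst c).
Proof. by split; [exact: (measurable_cst (sre c))|exact: (measurable_cst (sim c))]. Qed.

Lemma measurable_sfun_sofR (m : T -> R) :
  measurable_fun setT m -> measurable_sfun (sofR k \o m).
Proof.
move=> mm; split.
  by rewrite (_ : _ \o _ = m)//; apply/funext => x /=; rewrite sre_sofR.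
rewrite (_ : _ \o _ = cst 0)//.
by apply/funext => x /=; rewrite sim_sofR.
Qed.

Lemma L2funP (f : T -> K^o) :
  reflect (measurable_sfun f /\ finite_norm mu 2%:E (sabs \o f)) (f \in L2fun).
Proof. by apply: (iffP idP); rewrite inE. Qed.

Lemma L2fun_Lfun (f : T -> K^o) :
  f \in L2fun -> (sabs \o f) \in Lfun mu 2%:E.
Proof.
move=> /L2funP[mf ff]; rewrite inE; apply/andP; split; rewrite inE//=.
exact: measurable_sabs.
Qed.

Lemma le_Lnorm2D (f g : T -> K^o) : f \in L2fun -> g \in L2fun ->
  (N2 (f \+ g) <= N2 f + N2 g)%E.
Proof.
move=> /L2funP[mf _] /L2funP[mg _].
have maf := measurable_sabs mf; have mag := measurable_sabs mg.
have := @eminkowski _ _ _ mu _ _ 2%:E maf mag (lee1n _).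
apply: le_trans; apply: le_Lnorm2.
- exact/measurable_sabs/measurable_sfunD.
- exact: measurable_funD.
- by move=> x /=; rewrite sabs_ge0 sabsD.
Qed.

Lemma Lnorm2_scale (a : K) (f : T -> K^o) : f \in L2fun ->
  N2 (fun x => a * f x) = ((sabs a)%:E * N2 f)%E.
Proof.
move=> Lf; rewrite (_ : sabs \o _ = fun x => sabs a * (sabs \o f) x); last first.
  by apply/funext => x /=; rewrite sabsM.
by rewrite Lnorm2Z ?L2fun_Lfun// ger0_norm// sabs_ge0.
Qed.

Lemma L2fun_submod_closed : submod_closed L2fun.
Proof.
have s0 : sabs (0 : K) = 0.
  by apply: (@sofR_inj R k); rewrite sofR_sabs normr0 sofR0.
split.
  apply/L2funP; split; first exact: measurable_sfun_cst.
  rewrite (_ : sabs \o _ = cst 0); last by apply/funext => x /=.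
  by apply: finite_norm_cst0; rewrite lee1n.
move=> a f g Lf Lg.
have Laf : (a *: f : T -> K^o) \in L2fun.
  apply/L2funP; split.
    by apply: measurable_sfunM; [exact: measurable_sfun_cst|case/L2funP : Lf].
  rewrite /finite_norm (Lnorm2_scale a Lf) lte_mul_pinfty ?lee_fin ?sabs_ge0//.
  by case/L2funP : Lf.
apply/L2funP; split.
  by apply: measurable_sfunD; [case/L2funP: Laf|case/L2funP: Lg].
apply: (le_lt_trans (le_Lnorm2D Laf Lg)); apply: lte_add_pinfty.
  by case/L2funP: Laf.
by case/L2funP: Lg.
Qed.

HB.instance Definition _ := GRing.isSubmodClosed.Build K (T -> K^o) L2fun
  L2fun_submod_closed.

Record L2fun_type := MkL2fun { L2fun_val :> T -> K^o; _ : L2fun_val \in L2fun }.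
HB.instance Definition _ := [isSub for L2fun_val].
HB.instance Definition _ := [Choice of L2fun_type by <:].
HB.instance Definition _ := [SubChoice_isSubLmodule of L2fun_type by <:].

Definition L2_ae_eq (f g : L2fun_type) :=
  `[< (f : T -> K^o) = (g : T -> K^o) %[ae mu] >].

Let L2_ae_eq_refl : reflexive L2_ae_eq.
Proof. by move=> f; apply/asboolP; exact: ae_eq_refl. Qed.

Let L2_ae_eq_sym : symmetric L2_ae_eq.
Proof.
by move=> f g; apply/idP/idP => /asboolP h; apply/asboolP; exact: ae_eq_sym.
Qed.

Let L2_ae_eq_trans : transitive L2_ae_eq.
Proof.
move=> g f h /asboolP fg /asboolP gh; apply/asboolP; exact: ae_eq_trans fg gh.
Qed.

Canonical L2_ae_eq_equiv :=
  EquivRel L2_ae_eq L2_ae_eq_refl L2_ae_eq_sym L2_ae_eq_trans.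

Local Open Scope quotient_scope.

(* [L2] is the space of classes modulo a.e. equality. *)
Definition L2 : Type := {eq_quot L2_ae_eq}.
HB.instance Definition _ := Choice.on L2.
HB.instance Definition _ := EqQuotient.on L2.

Lemma L2_eqP (f g : L2fun_type) :
  \pi_L2 f = \pi_L2 g <-> (f : T -> K^o) = (g : T -> K^o) %[ae mu].
Proof.
split; first by move/eqP; rewrite eqmodE => /asboolP.
by move=> fg; apply/eqP; rewrite eqmodE; exact/asboolP.
Qed.

Lemma L2_reprP (f : L2fun_type) :
  (repr (\pi_L2 f) : T -> K^o) = (f : T -> K^o) %[ae mu].
Proof. by apply/L2_eqP; rewrite reprK. Qed.

Definition L2_zero : L2 := \pi_L2 0.
Definition L2_opp (x : L2) : L2 := \pi_L2 (- repr x).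
Definition L2_add (x y : L2) : L2 := \pi_L2 (repr x + repr y).
Definition L2_scale (a : K) (x : L2) : L2 := \pi_L2 (a *: repr x).

Lemma pi_L2_opp f : L2_opp (\pi_L2 f) = \pi_L2 (- f).
Proof.
apply/L2_eqP; move: (L2_reprP f); apply: filterS => t /= h It.
by rewrite /= /GRing.opp /= h.
Qed.

Lemma pi_L2_add f g : L2_add (\pi_L2 f) (\pi_L2 g) = \pi_L2 (f + g).
Proof.
apply/L2_eqP; apply: filterS2 (L2_reprP f) (L2_reprP g) => t /= hf hg It.
by rewrite /GRing.add /= hf// hg.
Qed.

Lemma pi_L2_scale a f : L2_scale a (\pi_L2 f) = \pi_L2 (a *: f).
Proof.
apply/L2_eqP; move: (L2_reprP f); apply: filterS => t /= h It.
by rewrite /GRing.scale /= h.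
Qed.

Let addA : associative L2_add.
Proof.
elim/quotW => f; elim/quotW => g; elim/quotW => h.
by rewrite (pi_L2_add g h) (pi_L2_add f g) !pi_L2_add addrA.
Qed.
Let addC : commutative L2_add.
Proof. by elim/quotW => f; elim/quotW => g; rewrite !pi_L2_add addrC. Qed.
Let add0 : left_id L2_zero L2_add.
Proof. by elim/quotW => f; rewrite pi_L2_add add0r. Qed.
Let addN : left_inverse L2_zero L2_opp L2_add.
Proof. by elim/quotW => f; rewrite pi_L2_opp pi_L2_add addNr. Qed.

HB.instance Definition _ := GRing.isZmodule.Build L2 addA addC add0 addN.

Lemma pi_L2D f g : \pi_L2 (f + g) = \pi_L2 f + \pi_L2 g.
Proof. by rewrite -pi_L2_add. Qed.

Let scaleA a b x : L2_scale a (L2_scale b x) = L2_scale (a * b) x.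
Proof. by elim/quotW: x => f; rewrite (pi_L2_scale b f) !pi_L2_scale scalerA. Qed.
Let scale1 : left_id 1 L2_scale.
Proof. by elim/quotW => f; rewrite pi_L2_scale scale1r. Qed.
Let scaleDr : right_distributive L2_scale +%R.
Proof.
move=> a; elim/quotW => f; elim/quotW => g.
by rewrite -pi_L2D !pi_L2_scale scalerDr pi_L2D.
Qed.
Let scaleDl x : {morph L2_scale^~ x : a b / a + b}.
Proof.
by move=> a b; elim/quotW: x => f; rewrite !pi_L2_scale scalerDl pi_L2D.
Qed.

HB.instance Definition _ :=
  GRing.Zmodule_isLmodule.Build K L2 scaleA scale1 scaleDr scaleDl.

Lemma pi_L2Z a f : \pi_L2 (a *: f) = a *: \pi_L2 f.
Proof. by rewrite -pi_L2_scale. Qed.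

Definition L2_norm (x : L2) : R := fine (N2 (repr x)).

Lemma L2_norm_pi (f : L2fun_type) : L2_norm (\pi_L2 f) = fine (N2 f).
Proof.
rewrite /L2_norm; congr fine; apply: ae_eq_Lnorm2.
- by case: (repr _) => g /= /L2funP[mg _]; exact: measurable_sabs.
- by case: f => g /= /L2funP[mg _]; exact: measurable_sabs.
- by move: (L2_reprP f); apply: filterS => x /= h Ix; rewrite h.
Qed.

Let L2_finite (f : L2fun_type) : N2 f \is a fin_num.
Proof.
rewrite ge0_fin_numE ?Lnorm_ge0//.
by case: f => g /= /L2funP[].
Qed.

Let L2_normE (f : L2fun_type) : (L2_norm (\pi_L2 f))%:E = N2 f.
Proof. by rewrite L2_norm_pi fineK. Qed.

Let normD x y : sofR k (L2_norm (x + y)) <= sofR k (L2_norm x) + sofR k (L2_norm y).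
Proof.
rewrite -sofRD ler_sofR; elim/quotW: x => f; elim/quotW: y => g.
rewrite -pi_L2D -lee_fin EFinD !L2_normE.
by apply: le_Lnorm2D; [exact: (valP f)|exact: (valP g)].
Qed.

Let normZ a x : L2_norm (a *: x) = sabs a * L2_norm x.
Proof.
elim/quotW: x => f; apply: EFin_inj.
by rewrite -pi_L2Z EFinM !L2_normE -Lnorm2_scale//; exact: (valP f).
Qed.

Let norm0_eq0 x : sofR k (L2_norm x) = 0 -> x = 0.
Proof.
rewrite -(sofR0 R k) => /sofR_inj; elim/quotW: x => f f0.
have : N2 f = 0%E by rewrite -L2_normE f0.
move/Lnorm_eq0_eq0 => h; rewrite -[0]/(\pi_L2 0); apply/L2_eqP.
have mf : measurable_fun setT (EFin \o (sabs \o f)).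
  by apply/measurable_EFinP; case: {f0 h} f => g /= /L2funP[mg _]; exact: measurable_sabs.
move: (h mf) => /(_ (lte0n _)) => H.
have {}H : ae_eq mu setT (EFin \o (sabs \o f)) (cst 0%E) by apply: H.
by move: H; apply: filterS => t /= H It; apply: sabs0_eq0; case: (H It).
Qed.

Let normN x : sofR k (L2_norm (- x)) = sofR k (L2_norm x).
Proof.
congr sofR; rewrite -scaleN1r normZ (_ : sabs _ = 1) ?mul1r//.
apply: (@sofR_inj R k); rewrite sofR_sabs normrN1; by case: (k).
Qed.

Let normMn x n : sofR k (L2_norm (x *+ n)) = sofR k (L2_norm x) *+ n.
Proof.
rewrite -scaler_nat normZ sofRM sofR_sabs normr_nat.
by rewrite mulr_natl.
Qed.

HB.instance Definition _ := Num.Zmodule_isNormed.Build K L2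
  normD norm0_eq0 normMn normN.

End L2.
Arguments L2fun {R} k {d T} mu.
Arguments L2 {R} k {d T} mu.

(* The values of [op] outside [dom] are irrelevant. *)
Record operator (K : numFieldType) (V : lmodType K) := Operator {
  dom : set V;
  op :> V -> V;
  dom0 : dom 0;
  domP : forall (a : K) (x y : V), dom x -> dom y -> dom (a *: x + y);
  opP : forall (a : K) (x y : V), dom x -> dom y ->
    op (a *: x + y) = a *: op x + op y
}.

Definition densely_defined (K : numFieldType) (V : normedModType K)
    (A : operator V) :=
  dense (dom A).

Definition symmetric_operator (K : numFieldType) (V : lmodType K)
    (ip : V -> V -> K) (A : operator V) :=
  forall x y, dom A x -> dom A y -> ip (A x) y = ip x (A y).

Definition separable_space (T : topologicalType) :=
  exists2 S : set T, countable S & dense S.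

(* The library's measurable types are pointed; asking for a point is harmless
   here, since a space that carries a probability measure is not empty. *)
#[short(type="pointedMetricType")]
HB.structure Definition PointedMetric (K : numDomainType) :=
  {M of Pointed M & Metric K M}.

Definition borelType (T : topologicalType) := g_sigma_algebraType (@open T).

Section multiplication_operator.
Context (R : realType) (k : scalar_kind).
Context (d : measure_display) (T : measurableType d).
Variables (mu : {measure set T -> \bar R}) (m : {mfun T >-> R}).
Local Notation K := (scalars R k).
Local Open Scope quotient_scope.

Definition smul (f : T -> K^o) : T -> K^o := fun x => sofR k (m x) * f x.

(* The choice of the representative is irrelevant: see [mulop_domP] and
   [mulop_funP]. *)
Definition mulop_dom : set (L2 k mu) :=
  [set g | smul (repr g : L2fun_type k mu) \in L2fun k mu].

(* [insubd 0 f] is [f] as an element of [L2fun_type] when [f \in L2fun k mu]. *)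
Definition mulop_fun (g : L2 k mu) : L2 k mu :=
  \pi_(L2 k mu)
    (insubd 0 (smul (repr g : L2fun_type k mu)) : L2fun_type k mu).

Let L2fun_ae (f g : T -> K^o) : measurable_sfun f -> measurable_sfun g ->
  f = g %[ae mu] -> f \in L2fun k mu -> g \in L2fun k mu.
Proof.
move=> mf mg fg /L2funP[_ ff]; apply/L2funP; split=> //.
rewrite /finite_norm -(@ae_eq_Lnorm2 _ _ _ mu (sabs \o f))//.
- exact: measurable_sabs.
- exact: measurable_sabs.
- by move: fg; apply: filterS => x /= h Ix; rewrite h.
Qed.

Let measurable_smul (f : L2fun_type k mu) : measurable_sfun (smul f).
Proof.
case: f => f /= /L2funP[mf _]; apply: measurable_sfunM => //.
exact: measurable_sfun_sofR.
Qed.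

Let smul_repr (f : L2fun_type k mu) :
  smul (repr (\pi_(L2 k mu) f) : L2fun_type k mu) = smul f %[ae mu].
Proof.
by move: (L2_reprP f); apply: filterS => x /= h Ix; rewrite /smul h.
Qed.

Lemma mulop_domP (f : L2fun_type k mu) :
  mulop_dom (\pi_(L2 k mu) f) <-> smul f \in L2fun k mu.
Proof.
split; apply: L2fun_ae; try exact: measurable_smul; first exact: smul_repr.
by apply: ae_eq_sym; exact: smul_repr.
Qed.

Lemma mulop_funP (f g : L2fun_type k mu) :
  (g : T -> K^o) = smul f -> mulop_fun (\pi_(L2 k mu) f) = \pi_(L2 k mu) g.
Proof.
move=> gf; apply/L2_eqP; rewrite gf.
have Lf : smul f \in L2fun k mu by rewrite -gf; exact: (valP g).
have /mulop_domP Lrf := Lf.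
have rE : L2fun_val (insubd (0 : L2fun_type k mu)
    (smul (repr (\pi_(L2 k mu) f) : L2fun_type k mu))) =
    smul (repr (\pi_(L2 k mu) f) : L2fun_type k mu).
  by apply: (@insubdK _ _ (L2fun_type k mu) 0); exact: Lrf.
by apply: ae_eq_trans (smul_repr f); rewrite rE; exact: ae_eq_refl.
Qed.

Let smulP (a : K) (f g : T -> K^o) : smul (a *: f + g) = a *: smul f + smul g.
Proof.
apply/funext => x.
by rewrite /smul -[in LHS]/((a * f x) + g x) mulrDr mulrCA.
Qed.

Let mulop_dom0 : mulop_dom 0.
Proof.
apply/mulop_domP; rewrite (_ : smul _ = 0) ?rpred0//.
by apply/funext => x; rewrite /smul mulr0.
Qed.

Let mulop_domL a x y :
  mulop_dom x -> mulop_dom y -> mulop_dom (a *: x + y).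
Proof.
elim/quotW: x => f; elim/quotW: y => g /mulop_domP Lf /mulop_domP Lg.
rewrite -pi_L2Z -pi_L2D; apply/mulop_domP.
by rewrite smulP rpredD// rpredZ.
Qed.

Let mulop_linear a x y : mulop_dom x -> mulop_dom y ->
  mulop_fun (a *: x + y) = a *: mulop_fun x + mulop_fun y.
Proof.
elim/quotW: x => f; elim/quotW: y => g /mulop_domP Lf /mulop_domP Lg.
rewrite (@mulop_funP f (MkL2fun Lf))// (@mulop_funP g (MkL2fun Lg))//.
rewrite -!pi_L2Z -!pi_L2D; apply: mulop_funP.
by rewrite smulP.
Qed.

Definition mulop : operator (L2 k mu) :=
  Operator mulop_dom0 mulop_domL mulop_linear.

End multiplication_operator.
Arguments mulop {R} k {d T} mu m.

(* Main.v *)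
Require Import Defs.
From HB Require Import structures.
From mathcomp Require Import all_boot all_order all_algebra.
From mathcomp Require Import all_classical all_reals all_analysis.
From mathcomp Require Import measurable_realfun complex spectral.
From mathcomp Require Import ring lra.

Set Implicit Arguments.
Unset Strict Implicit.
Unset Printing Implicit Defensive.

Import Order.TTheory GRing.Theory Num.Theory.
Import numFieldNormedType.Exports.

Local Open Scope classical_set_scope.
Local Open Scope ring_scope.

(** Let [x] be a sequence whose graph under [A] is dense in the graph of [A]. For
each [n], compress [A] to the span of [x_0, ..., x_(n-1)] and diagonalize: in a
suitable Parseval frame the vectors become functions [q_j] on a finite set and
[A] becomes multiplication by a function [m]. Weights [w] chosen as a summable
combination of the [|q_j|^2] make this set a probability space on which
[v_j = q_j / sqrt w] is bounded by a constant independent of [n] and [m] has second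
moment at most 1. The joint law of the bounded transform [y = m / (1 + |m|)] and of
all the [v_j] therefore lives on a fixed compact cube.

The cube is a continuous image of the Cantor space, and along an ultrafilter the
probabilities of all the cylinders of the Cantor space converge; cutting the unit
interval according to the limit probabilities realizes the limit law there. The
isometry identities and the inequality
[E |y v_i - (1 - |y|) v_j|^2 <= |A x_i - x_j|^2] pass to the limit, so that
[x_j |-> v_j] extends to an isometry [U], and the density of the graph turns the
inequality into [y (U z) = (1 - |y|) U (A z)]. The moment bound forces [|y| < 1]
almost everywhere, and one divides by [1 - |y|]. *)

Lemma continuousT_comp (S T U : topologicalType) (f : S -> T) (g : T -> U) :
  continuous f -> continuous g -> continuous (g \o f).
Proof.
move=> f_cont g_cont x; apply: continuous_comp; first exact: f_cont.
exact: g_cont.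
Qed.

(** * Scalars and real-valued norms *)

Section scalar_morphisms.
Variables (R : realType) (k : scalar_kind).
Local Notation K := (scalars R k).
Implicit Types (x y : K) (a : R).

Let sconj_zmod_morphism : zmod_morphism (@sconj R k).
Proof. by case: k => x y //; rewrite /sconj rmorphB. Qed.

Let sconj_monoid_morphism : monoid_morphism (@sconj R k).
Proof. by case: k; split=> // [|x y]; rewrite /sconj (rmorph1, rmorphM). Qed.

HB.instance Definition _ :=
  GRing.isZmodMorphism.Build K K (@sconj R k) sconj_zmod_morphism.
HB.instance Definition _ :=
  GRing.isMonoidMorphism.Build K K (@sconj R k) sconj_monoid_morphism.

Let sofR_zmod_morphism : zmod_morphism (@sofR R k).
Proof. by move=> x y; apply/eqP; rewrite eq_sym subr_eq -sofRD subrK. Qed.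

Let sofR_monoid_morphism : monoid_morphism (@sofR R k).
Proof. by split=> [|x y]; [case: k|exact: sofRM]. Qed.

HB.instance Definition _ :=
  GRing.isZmodMorphism.Build R K (@sofR R k) sofR_zmod_morphism.
HB.instance Definition _ :=
  GRing.isMonoidMorphism.Build R K (@sofR R k) sofR_monoid_morphism.

Let sre_zmod_morphism : zmod_morphism (@sre R k).
Proof. by move=> x y; apply/eqP; rewrite eq_sym subr_eq -sreD subrK. Qed.

Let sim_zmod_morphism : zmod_morphism (@sim R k).
Proof. by move=> x y; apply/eqP; rewrite eq_sym subr_eq -simD subrK. Qed.

HB.instance Definition _ :=
  GRing.isZmodMorphism.Build K R (@sre R k) sre_zmod_morphism.
HB.instance Definition _ :=
  GRing.isZmodMorphism.Build K R (@sim R k) sim_zmod_morphism.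

Lemma sconjK : involutive (@sconj R k).
Proof. by case: k => // x; rewrite /sconj conjCK. Qed.

Lemma sconj_sofR a : sconj (sofR k a) = sofR k a.
Proof. by case: k => //=; apply/eqP; rewrite eq_complex /= oppr0 !eqxx. Qed.

Lemma mul_sconj x : x * sconj x = sofR k (sabs x ^+ 2).
Proof.
rewrite rmorphXn /= sofR_sabs; case: k x => x; last by rewrite normCK.
by rewrite real_normK ?num_real.
Qed.

Lemma sofR_sre x : 0 <= x -> sofR k (sre x) = x.
Proof.
case: k x => //= -[a b]; rewrite lecE /= => /andP[/eqP <- _].
by apply/eqP; rewrite eq_complex /= !eqxx.
Qed.

Lemma ltr_sofR (a b : R) : (sofR k a < sofR k b) = (a < b).
Proof. by rewrite !lt_neqAle ler_sofR (inj_eq (@sofR_inj R k)). Qed.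

Lemma sabs_sqr x : sabs x ^+ 2 = sre x ^+ 2 + sim x ^+ 2.
Proof. by rewrite sabs_sqrt sqr_sqrtr// addr_ge0// sqr_ge0. Qed.

Lemma sabs_sofR a : sabs (sofR k a) = `|a|.
Proof. by apply: (@sofR_inj R k); rewrite sofR_sabs sofR_norm. Qed.

Lemma sabs0 : sabs (0 : K) = 0.
Proof. by rewrite -(sofR0 R k) sabs_sofR normr0. Qed.

Lemma normr_sre_le x : `|sre x| <= sabs x.
Proof. by rewrite sabs_sqrt -sqrtr_sqr ler_wsqrtr// lerDl sqr_ge0. Qed.

Lemma normr_sim_le x : `|sim x| <= sabs x.
Proof. by rewrite sabs_sqrt -sqrtr_sqr ler_wsqrtr// lerDr sqr_ge0. Qed.

(* Over the reals the imaginary part [b] is dropped. *)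
Definition smk (a b : R) : K :=
  match k return scalars R k with
  | RealScalars => a
  | ComplexScalars => Complex a b
  end.

Lemma sre_smk a b : sre (smk a b) = a. Proof. by rewrite /smk; case: (k). Qed.

Lemma sim_smk a b : sim (smk a b) = if k is ComplexScalars then b else 0.
Proof. by rewrite /smk; case: (k). Qed.

Lemma smk_eta x : smk (sre x) (sim x) = x.
Proof. by rewrite /smk; case: (k) x => // -[]. Qed.

Lemma smkE a b : smk a b = sofR k a + smk 0 1 * sofR k b.
Proof.
rewrite /smk; case: (k) => /=; first by rewrite mul0r addr0.
apply/eqP.
by rewrite eq_complex /= !(mul0r, mul1r, mulr0, subr0, addr0, add0r) !eqxx.
Qed.

End scalar_morphisms.

Section rnorm.
Variables (R : realType) (k : scalar_kind).
Local Notation K := (scalars R k).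

Definition rnorm (V : normedZmodType K) (x : V) : R := sre `|x|.

Section normed_zmodule.
Variable V : normedZmodType K.
Implicit Types x y z : V.

Lemma sofR_rnorm x : sofR k (rnorm x) = `|x|.
Proof. exact: sofR_sre. Qed.

Lemma rnorm_ge0 x : 0 <= rnorm x.
Proof. by rewrite -(ler_sofR k) sofR_rnorm sofR0. Qed.

Lemma rnorm0 : rnorm (0 : V) = 0.
Proof. by rewrite /rnorm normr0 raddf0. Qed.

Lemma rnorm_le0 x : rnorm x <= 0 -> x = 0.
Proof.
move=> x0; apply: normr0_eq0; rewrite -sofR_rnorm -(sofR0 R k).
by congr (sofR k _); apply/le_anti; rewrite x0 rnorm_ge0.
Qed.

Lemma rnormD x y : rnorm (x + y) <= rnorm x + rnorm y.
Proof. by rewrite -(ler_sofR k) rmorphD /= !sofR_rnorm ler_normD. Qed.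

Lemma rnorm_distC x y : rnorm (x - y) = rnorm (y - x).
Proof. by rewrite /rnorm distrC. Qed.

Lemma rnorm_distD y x z : rnorm (x - z) <= rnorm (x - y) + rnorm (y - z).
Proof. by rewrite (le_trans _ (rnormD _ _))// addrA subrK. Qed.

Lemma rnorm_dist_dist x y : `|rnorm x - rnorm y| <= rnorm (x - y).
Proof.
have := rnormD (y - x) x; have := rnormD (x - y) y.
rewrite !subrK (rnorm_distC y) => xy yx.
by rewrite ler_norml; apply/andP; split; lra.
Qed.

Lemma rnorm_distDB x y z x' y' z' :
  `|rnorm (x + y - z) - rnorm (x' + y' - z')| <=
  rnorm (x - x') + rnorm (y - y') + rnorm (z - z').
Proof.
rewrite (le_trans (rnorm_dist_dist _ _))// (rnorm_distC z).
have -> : x + y - z - (x' + y' - z') = x - x' + (y - y') + (z' - z).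
  rewrite [x - x' + _]addrACA -opprD [RHS]addrACA [LHS]addrC opprB [LHS]addrACA.
  by rewrite (addrC z').
by rewrite (le_trans (rnormD _ _))// lerD2r rnormD.
Qed.

End normed_zmodule.

Lemma rnormZ (V : normedModType K) (a : K) (x : V) :
  rnorm (a *: x) = sabs a * rnorm x.
Proof.
by apply: (@sofR_inj R k); rewrite rmorphM /= !sofR_rnorm normrZ.
Qed.

Definition lincomb (V : lmodType K) (x : nat -> V) (s : seq (K * nat)) : V :=
  \sum_(p <- s) p.1 *: x p.2.

Lemma linear_lincomb (V W : lmodType K) (f : {linear V -> W}) x s :
  f (lincomb x s) = lincomb (f \o x) s.
Proof. by rewrite linear_sum; apply: eq_bigr => p _; exact: linearZ. Qed.

Lemma lincombE (T : Type) (u : nat -> T -> K^o) s w :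
  lincomb u s w = lincomb (u^~ w) s.
Proof. by rewrite /lincomb fct_sumE. Qed.

End rnorm.

Section operator_theory.
Variables (K : numFieldType) (V : lmodType K) (A : operator V).

Lemma domD x y : dom A x -> dom A y -> dom A (x + y).
Proof. by move=> Dx Dy; rewrite -[x]scale1r; exact: domP. Qed.

Lemma domZ a x : dom A x -> dom A (a *: x).
Proof. by move=> Dx; rewrite -[_ *: x]addr0; apply: domP => //; exact: dom0. Qed.

Lemma opD x y : dom A x -> dom A y -> A (x + y) = A x + A y.
Proof. by move=> Dx Dy; rewrite -{1}[x]scale1r opP// scale1r. Qed.

Lemma op0 : A 0 = 0.
Proof. by apply: (addrI (A 0)); rewrite -opD ?addr0//; exact: dom0. Qed.

Lemma opZ a x : dom A x -> A (a *: x) = a *: A x.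
Proof.
by move=> Dx; rewrite -[_ *: x]addr0 opP ?op0 ?addr0//; exact: dom0.
Qed.

Lemma opB x y : dom A x -> dom A y -> A (x - y) = A x - A y.
Proof.
by move=> Dx Dy; rewrite -[- y]scaleN1r -[- A y]scaleN1r opD ?opZ//; exact: domZ.
Qed.

Lemma dom_sumZ (I : finType) (c : I -> K) (x : I -> V) :
  (forall i, dom A (x i)) -> dom A (\sum_i c i *: x i).
Proof.
move=> Dx; apply: big_ind => [|x1 x2|i _].
- exact: dom0.
- exact: domD.
- exact: domZ.
Qed.

Lemma op_sumZ (I : finType) (c : I -> K) (x : I -> V) :
  (forall i, dom A (x i)) -> A (\sum_i c i *: x i) = \sum_i c i *: A (x i).
Proof.
move=> Dx; pose P u v := dom A u /\ A u = v.
suff [] : P (\sum_i c i *: x i) (\sum_i c i *: A (x i)) by [].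
apply: (big_ind2 P) => [|u u' v v' [Du <-] [Dv <-]|i _].
- by split; [exact: dom0|exact: op0].
- by rewrite /P opD//; split=> //; exact: domD.
- by rewrite /P opZ//; split=> //; exact: domZ.
Qed.

End operator_theory.

(** * Hermitian matrices and Parseval frames *)

Lemma hermitian_eigenbasis_complex (R : realType) n (M : 'M[R[i]]_n) :
  (forall i j, M i j = (M j i)^*) ->
  exists (lam : 'I_n -> R) (q : 'I_n -> 'I_n -> R[i]),
    (forall i j, \sum_l q l i * (q l j)^* = (i == j)%:R) /\
    (forall l i, (lam l)%:C%C * q l i = \sum_j M i j * q l j).
Proof.
move=> M_herm; have hM : M \is hermsymmx.
  apply/is_hermitianmxP; rewrite expr0 scale1r; apply/matrixP => i j.
  by rewrite !mxE M_herm.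
have /hermitian_normalmx/orthomx_spectralP := hM.
have /mxOverP D_real := hermitian_spectral_diag_real hM.
have P_unitary := spectral_unitarymx M; rewrite (invmx_unitary P_unitary).
have PtP : ((spectralmx M)^t Num.conj *m spectralmx M)%sesqui = 1%:M.
  by rewrite -(invmx_unitary P_unitary) mulVmx ?unitarymx_unit.
have PPt : (spectralmx M *m (spectralmx M)^t Num.conj)%sesqui = 1%:M.
  exact/unitarymxP.
move: PtP PPt D_real; set P := spectralmx M; set D := spectral_diag M.
move=> PtP PPt D_real ME.
exists (fun l => complex.Re (D 0 l)), (fun l i => (P l i)^*); split=> [i j|l i].
  move/matrixP : PtP => /(_ i j); rewrite !mxE => <-.
  by apply: eq_bigr => l _; rewrite !mxE conjCK.
have /matrixP/(_ i l) :
    (M *m P^t Num.conj = P^t Num.conj *m diag_mx D)%sesqui.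
  by rewrite ME -!mulmxA PPt mulmx1.
rewrite mul_mx_diag !mxE mulrC RRe_real; last exact: D_real.
by move=> <-; apply: eq_bigr => j _; rewrite !mxE.
Qed.

(* Over the reals, the real and imaginary parts of a complex eigenbasis give
   twice as many vectors: not orthogonal, but with the same Parseval identity. *)
Lemma hermitian_eigenframe (R : realType) (k : scalar_kind) n
    (M : 'M[scalars R k]_n) :
  (forall i j, M i j = sconj (M j i)) ->
  exists (N : nat) (lam : 'I_N -> R) (q : 'I_N -> 'I_n -> scalars R k),
    (forall i j, \sum_l q l i * sconj (q l j) = (i == j)%:R) /\
    (forall l i, sofR k (lam l) * q l i = \sum_j M i j * q l j).
Proof.
case: k M => M M_herm; last first.
  have [lam [q qP]] := hermitian_eigenbasis_complex M_herm.
  by exists n, lam, q.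
have MC_herm i j : map_mx (real_complex R) M i j =
    (map_mx (real_complex R) M j i)^*.
  by rewrite !mxE M_herm /=; apply/eqP; rewrite eq_complex /= oppr0 !eqxx.
have [lam [q [qq qM]]] := hermitian_eigenbasis_complex MC_herm.
exists (n + n)%N,
  (fun l : 'I_(n + n) =>
     lam (match fintype.split l with inl l | inr l => l end)),
  (fun (l : 'I_(n + n)) i => match fintype.split l with
              | inl l => complex.Re (q l i)
              | inr l => complex.Im (q l i)
              end).
split=> [i j|l i].
  rewrite big_split_ord/=.
  under eq_bigr do rewrite -[lshift _ _]/(unsplit (inl _)) unsplitK.
  under [X in _ + X]eq_bigr do rewrite -[rshift _ _]/(unsplit (inr _)) unsplitK.
  rewrite -big_split/=.
  have -> : (i == j)%:R = complex.Re ((i == j)%:R : R[i]) by case: eqP.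
  rewrite -qq raddf_sum; apply: eq_bigr => l _.
  by case: (q l i) (q l j) => a b [c d] /=; rewrite mulrN opprK.
case: (fintype.split l) => {}l; have := qM l i; under eq_bigr do rewrite mxE.
  move=> /(congr1 (@complex.Re R)); rewrite raddf_sum /=.
  case: (q l i) => a b /=; rewrite mul0r subr0 => ->.
  by apply: eq_bigr => j _; case: (q l j) => c d /=; rewrite mul0r subr0.
move=> /(congr1 (@complex.Im R)); rewrite raddf_sum /=.
case: (q l i) => a b /=; rewrite mul0r addr0 => ->.
by apply: eq_bigr => j _; case: (q l j) => c d /=; rewrite mul0r addr0.
Qed.

Section inner_product.
Variables (R : realType) (k : scalar_kind).
Local Notation K := (scalars R k).
Variables (H : normedModType K) (ip : {dot H for @sconj R k}).
Hypothesis ip_norm : forall x : H, `|x| ^+ 2 = ip x x.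
Implicit Types (x y z : H) (a : K).

Lemma ipC x y : ip x y = sconj (ip y x).
Proof. by rewrite hermitian_subproof expr0 mul1r. Qed.

Lemma ipDl x y z : ip (x + y) z = ip x z + ip y z.
Proof. exact: linearDl. Qed.

Lemma ipBl x y z : ip (x - y) z = ip x z - ip y z.
Proof. exact: linearBl. Qed.

Lemma ipZl a y z : ip (a *: y) z = a * ip y z.
Proof. exact: linearZl_LR. Qed.

Lemma ipBr x y z : ip x (y - z) = ip x y - ip x z.
Proof. by rewrite ipC ipBl rmorphB /= -!ipC. Qed.

Lemma ipZr a y z : ip y (a *: z) = sconj a * ip y z.
Proof. by rewrite ipC ipZl rmorphM /= -ipC. Qed.

Lemma ip_suml (I : finType) (F : I -> H) z :
  ip (\sum_i F i) z = \sum_i ip (F i) z.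
Proof. exact: linear_sumlz. Qed.

Lemma ip_sumr (I : finType) (F : I -> H) z :
  ip z (\sum_i F i) = \sum_i ip z (F i).
Proof.
by rewrite ipC ip_suml rmorph_sum; apply: eq_bigr => i _; rewrite /= -ipC.
Qed.

Lemma ip_rnorm x : ip x x = sofR k (rnorm x ^+ 2).
Proof. by rewrite -ip_norm -sofR_rnorm rmorphXn. Qed.

Section frame.
Variables (I : finType) (e : I -> H).

Definition frame_proj x : H := \sum_i ip x (e i) *: e i.

Let frame_proj_linear : linear frame_proj.
Proof.
move=> a x y; rewrite scaler_sumr -big_split; apply: eq_bigr => i _ /=.
by rewrite ipDl ipZl scalerDl scalerA.
Qed.

HB.instance Definition _ :=
  GRing.isLinear.Build K H H *:%R frame_proj frame_proj_linear.

Lemma ip_frame_proj x y :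
  ip (frame_proj x) y = \sum_i ip x (e i) * sconj (ip y (e i)).
Proof. by rewrite ip_suml; apply: eq_bigr => i _; rewrite ipZl -ipC. Qed.

Lemma ip_frame_projC x y : ip (frame_proj x) y = ip x (frame_proj y).
Proof.
rewrite (ipC x) !ip_frame_proj rmorph_sum; apply: eq_bigr => i _ /=.
by rewrite rmorphM /= sconjK mulrC.
Qed.

Lemma ip_frame_projE x :
  ip (frame_proj x) x = sofR k (\sum_i sabs (ip x (e i)) ^+ 2).
Proof.
by rewrite ip_frame_proj rmorph_sum; apply: eq_bigr => i _; exact: mul_sconj.
Qed.

Lemma frame_parseval x :
  frame_proj x = x -> \sum_i sabs (ip x (e i)) ^+ 2 = rnorm x ^+ 2.
Proof.
by move=> xE; apply: (@sofR_inj R k); rewrite -ip_frame_projE xE ip_rnorm.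
Qed.

Hypothesis frame_projK : forall i, frame_proj (e i) = e i.

Lemma frame_bessel x : \sum_i sabs (ip x (e i)) ^+ 2 <= rnorm x ^+ 2.
Proof.
pose p := frame_proj x.
have pK : frame_proj p = p.
  rewrite {1}/p linear_sum; apply: eq_bigr => i _.
  by rewrite linearZ/= frame_projK.
have px : ip p x = ip x p by rewrite ip_frame_projC.
have pp : ip p p = ip p x by rewrite px -ip_frame_projC pK.
rewrite -subr_ge0 -(ler_sofR k) sofR0 rmorphB /= -ip_frame_projE -/p -ip_rnorm.
have -> : ip x x - ip p x = ip (x - p) (x - p).
  by rewrite ipBl !ipBr pp px subrr subr0.
by rewrite ip_rnorm -(sofR0 R k) ler_sofR sqr_ge0.
Qed.

End frame.

(* [e l] is the [l]-th eigenvector of the Gram matrix, normalized: it vanishes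
   when its eigenvalue does, and then [(Num.sqrt 0)^-1 = 0]. *)
Lemma parseval_frame_span n (x : 'I_n -> H) :
  exists (N : nat) (c : 'I_N -> 'I_n -> K),
    forall i, frame_proj (fun l => \sum_j c l j *: x j) (x i) = x i.
Proof.
pose G := \matrix_(i, j) ip (x i) (x j).
have [|N [lam [q [qq qG]]]] := @hermitian_eigenframe R k n G.
  by move=> i j; rewrite !mxE; exact: ipC.
pose f l := \sum_j sconj (q l j) *: x j.
have ip_f i l : ip (x i) (f l) = sofR k (lam l) * q l i.
  rewrite ip_sumr qG; apply: eq_bigr => j _.
  by rewrite ipZr sconjK mxE mulrC.
have fE i : \sum_l q l i *: f l = x i.
  under eq_bigr do rewrite scaler_sumr.
  rewrite exchange_big (bigD1 i)//= -[RHS]addr0; congr (_ + _).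
    under eq_bigr do rewrite scalerA.
    by rewrite -scaler_suml qq eqxx scale1r.
  apply: big1 => j ji; under eq_bigr do rewrite scalerA.
  by rewrite -scaler_suml qq eq_sym (negbTE ji) scale0r.
have f_norm l : rnorm (f l) ^+ 2 = lam l * \sum_i sabs (q l i) ^+ 2.
  apply: (@sofR_inj R k); rewrite -ip_rnorm {1}/f ip_suml rmorphM rmorph_sum /=.
  rewrite mulr_sumr; apply: eq_bigr => i _.
  by rewrite ipZl ip_f -mul_sconj mulrCA (mulrC (q l i)).
exists N, (fun l i => sofR k (Num.sqrt (lam l))^-1 * sconj (q l i)) => i.
rewrite -[RHS]fE; apply: eq_bigr => l _.
have -> : \sum_j (sofR k (Num.sqrt (lam l))^-1 * sconj (q l j)) *: x j =
    sofR k (Num.sqrt (lam l))^-1 *: f l.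
  by rewrite scaler_sumr; apply: eq_bigr => j _; rewrite scalerA.
rewrite ipZr sconj_sofR ip_f scalerA; have [lam0|lam0] := leP (lam l) 0.
  suff -> : f l = 0 by rewrite !scaler0.
  have : rnorm (f l) ^+ 2 <= 0.
    by rewrite f_norm mulr_le0_ge0// sumr_ge0// => j _; exact: sqr_ge0.
  by rewrite exprn_even_le0//= => /eqP fl0; apply: rnorm_le0; rewrite fl0.
congr (_ *: f l); rewrite !mulrA -rmorphM /= mulrAC -rmorphM /= mulrAC.
by rewrite -invfM -expr2 sqr_sqrtr ?(ltW lam0)// mulVf ?gt_eqF// rmorph1 mul1r.
Qed.

Section frame_coord.
Variables (I : finType) (e : I -> H) (q : I -> K).

Definition frame_coord (x : H) : K^o := \sum_i ip x (e i) * q i.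

Let frame_coord_linear : linear frame_coord.
Proof.
move=> a x y; rewrite scaler_sumr -big_split; apply: eq_bigr => i _ /=.
by rewrite ipDl ipZl mulrDl -mulrA.
Qed.

HB.instance Definition _ :=
  GRing.isLinear.Build K H K^o *:%R frame_coord frame_coord_linear.

End frame_coord.

Lemma sum_sabs_frame_coord n N (e : 'I_n -> H) (q : 'I_N -> 'I_n -> K) x :
  (forall i j, \sum_l q l i * sconj (q l j) = (i == j)%:R) ->
  \sum_l sabs (frame_coord e (q l) x) ^+ 2 = \sum_i sabs (ip x (e i)) ^+ 2.
Proof.
move=> qq; apply: (@sofR_inj R k); rewrite !rmorph_sum /=.
transitivity (\sum_l \sum_i \sum_j
    ip x (e i) * sconj (ip x (e j)) * (q l i * sconj (q l j))).
  apply: eq_bigr => l _; rewrite -mul_sconj rmorph_sum mulr_suml /=.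
  apply: eq_bigr => i _; rewrite mulr_sumr; apply: eq_bigr => j _.
  by rewrite rmorphM mulrACA.
rewrite exchange_big; apply: eq_bigr => i _ /=.
rewrite exchange_big /= (bigD1 i)//= -mulr_sumr qq eqxx mulr1 mul_sconj.
rewrite big1 ?addr0// => j ji.
by rewrite -mulr_sumr qq eq_sym (negbTE ji) mulr0.
Qed.

(* The matrix [<A e_i, e_j>] represents the compression of [A] to the span of
   [e] lifted to the coefficients; [q l] are the coordinates along its
   eigenvectors. *)
Lemma spectral_coordinates (A : operator H) (x : nat -> H) n :
  symmetric_operator ip A -> (forall i, dom A (x i)) ->
  exists (N : nat) (lam : 'I_N -> R) (q : 'I_N -> {linear H -> K^o}),
  [/\ forall y, \sum_l sabs (q l y) ^+ 2 <= rnorm y ^+ 2,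
      forall s, all (fun p => p.2 < n)%N s ->
        \sum_l sabs (q l (lincomb x s)) ^+ 2 = rnorm (lincomb x s) ^+ 2 &
      forall l i, (i < n)%N -> sofR k (lam l) * q l (x i) = q l (A (x i))].
Proof.
move=> A_sym Dx.
have [m [c cP]] := parseval_frame_span (fun i : 'I_n => x i).
pose e l := \sum_i c l i *: x i.
have De l : dom A (e l) by exact: dom_sumZ.
have xK i : (i < n)%N -> frame_proj e (x i) = x i.
  by move=> ni; exact: (cP (Ordinal ni)).
have eK l : frame_proj e (e l) = e l.
  rewrite {2}/e linear_sum; apply: eq_bigr => i _.
  by rewrite linearZ /= xK.
pose M := \matrix_(i, j) ip (A (e i)) (e j).
have [|N [lam [q [qq qM]]]] := @hermitian_eigenframe R k m M.
  by move=> i j; rewrite !mxE A_sym//; exact: ipC.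
exists N, lam, (fun l => frame_coord e (q l) : {linear H -> K^o}); split.
- by move=> y; rewrite sum_sabs_frame_coord//; exact: frame_bessel.
- move=> s sn; rewrite sum_sabs_frame_coord//; apply: frame_parseval.
  rewrite linear_sum; apply: eq_big_seq => p ps /=.
  by rewrite linearZ /= xK//; exact: (allP sn).
move=> l i ni; rewrite -[in RHS](xK i ni) op_sumZ// linear_sum /=.
rewrite {1}/frame_coord mulr_sumr.
apply: eq_bigr => j _; rewrite linearZ /= mulrCA; congr (_ * _).
by rewrite qM; apply: eq_bigr => o _; rewrite mxE.
Qed.

End inner_product.

(** * Finite models *)

Section finite_model.
Variables (R : realType) (k : scalar_kind).
Local Notation K := (scalars R k).
Variables (H : normedModType K) (A : operator H) (x : nat -> H).

(* Chosen so that [\sum_j coord_weight j * |x_j|^2] and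
   [\sum_j coord_weight j * |A x_j|^2] are at most 1. *)
Definition coord_weight j : R :=
  2^-1 ^+ j.+1 / (1 + rnorm (x j) ^+ 2 + rnorm (A (x j)) ^+ 2).

Definition coord_radius j : R := Num.sqrt (coord_weight j)^-1.

(* On a finite probability space, [model_coord j] plays the part of [U (x j)] and
   [model_mult] that of the multiplier, up to index [n]. *)
Record finite_model (n : nat) := FiniteModel {
  model_atom : finType;
  model_weight : model_atom -> R;
  model_mult : model_atom -> R;
  model_coord : nat -> model_atom -> K^o;
  model_weight_ge0 : forall l, 0 <= model_weight l;
  model_weight_sum : \sum_l model_weight l = 1;
  model_coord_le : forall j l, sabs (model_coord j l) <= coord_radius j;
  model_coord_isometry : forall s, all (fun p => p.2 < n)%N s ->
    \sum_l model_weight l * sabs (lincomb model_coord s l) ^+ 2 =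
    rnorm (lincomb x s) ^+ 2;
  model_mult_dist : forall i j, (i < n)%N -> (j < n)%N ->
    \sum_l model_weight l *
      sabs (sofR k (model_mult l) * model_coord i l - model_coord j l) ^+ 2 <=
    rnorm (A (x i) - x j) ^+ 2;
  model_mult_moment : \sum_l model_weight l * model_mult l ^+ 2 <= 1
}.

Let norms_gt0 j : 0 < 1 + rnorm (x j) ^+ 2 + rnorm (A (x j)) ^+ 2.
Proof. by rewrite -addrA ltr_pwDl// addr_ge0// sqr_ge0. Qed.

Lemma coord_weight_gt0 j : 0 < coord_weight j.
Proof. by rewrite divr_gt0 ?norms_gt0// exprn_gt0// invr_gt0. Qed.

Lemma coord_radius_gt0 j : 0 < coord_radius j.
Proof. by rewrite sqrtr_gt0 invr_gt0 coord_weight_gt0. Qed.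

Lemma sum_coord_weight_le1 n (b : nat -> R) :
  (forall j, b j <= 1 + rnorm (x j) ^+ 2 + rnorm (A (x j)) ^+ 2) ->
  \sum_(j < n) coord_weight j * b j <= 1.
Proof.
move=> b_le; apply: (@le_trans _ _ (\sum_(j < n) 2^-1 ^+ j.+1)).
  apply: ler_sum => j _; rewrite mulrAC ler_pdivrMr ?norms_gt0//.
  by rewrite ler_wpM2l ?exprn_ge0 ?invr_ge0.
under eq_bigr do rewrite exprS; rewrite -(big_mkord xpredT (geometric 2^-1 2^-1)).
rewrite (le_trans (geometric_le_lim _ _ _ _)) ?invr_gt0 ?invr_ge0//.
  by rewrite gtr0_norm ?invr_gt0// invf_lt1// ltr1n.
by rewrite [1 - _](_ : _ = 2^-1) ?divff ?invr_eq0//; lra.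
Qed.

Section normalization.
Variables (n N : nat) (lam : 'I_N -> R) (q : 'I_N -> {linear H -> K^o}).
Hypothesis q_bessel : forall y, \sum_l sabs (q l y) ^+ 2 <= rnorm y ^+ 2.
Hypothesis q_parseval : forall s, all (fun p => p.2 < n)%N s ->
  \sum_l sabs (q l (lincomb x s)) ^+ 2 = rnorm (lincomb x s) ^+ 2.
Hypothesis q_mult :
  forall l i, (i < n)%N -> sofR k (lam l) * q l (x i) = q l (A (x i)).

Let w l := \sum_(j < n) coord_weight j * sabs (q l (x j)) ^+ 2.

Let term_ge0 l j : 0 <= coord_weight j * sabs (q l (x j)) ^+ 2.
Proof. by rewrite mulr_ge0 ?sqr_ge0// ltW// coord_weight_gt0. Qed.

Let w_ge0 l : 0 <= w l.
Proof. by apply: sumr_ge0 => j _; exact: term_ge0. Qed.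

Let term_le_w l j :
  (j < n)%N -> coord_weight j * sabs (q l (x j)) ^+ 2 <= w l.
Proof.
move=> jn; rewrite /w (bigD1 (Ordinal jn))//= lerDl.
by apply: sumr_ge0 => i _; exact: term_ge0.
Qed.

Let w_sum : \sum_l w l <= 1.
Proof.
rewrite exchange_big /=; under eq_bigr do rewrite -mulr_sumr.
apply: le_trans (sum_coord_weight_le1 n (b := fun j => rnorm (x j) ^+ 2) _).
  by apply: ler_sum => j _; rewrite ler_wpM2l// ltW// coord_weight_gt0.
by move=> j; rewrite addrAC lerDr addr_ge0// sqr_ge0.
Qed.

Let q_null l j : w l = 0 -> (j < n)%N -> q l (x j) = 0.
Proof.
move=> wl0 /(term_le_w l); rewrite wl0 pmulr_rle0 ?coord_weight_gt0//.
by rewrite exprn_even_le0//= => /eqP/sabs0_eq0.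
Qed.

Let normalized l (y : H) : K := sofR k (Num.sqrt (w l))^-1 * q l y.

Let w_normalized l y :
  w l * sabs (normalized l y) ^+ 2 = (w l != 0)%:R * sabs (q l y) ^+ 2.
Proof.
rewrite sabsM sabs_sofR exprMn mulrA; congr (_ * _).
rewrite real_normK ?num_real// exprVn sqr_sqrtr//.
by have [->|wl] := eqVneq (w l) 0; rewrite ?mul0r// mulfV.
Qed.

(* The extra atom [None], where everything vanishes, brings the mass to 1. *)
Let total_weight (o : option 'I_N) : R :=
  if o is Some l then w l else 1 - \sum_l w l.

Let total_mult (o : option 'I_N) : R := if o is Some l then lam l else 0.

Let total_coord (j : nat) (o : option 'I_N) : K^o :=
  if o is Some l then (if (j < n)%N then normalized l (x j) else 0) else 0.

Let total_coord_lincomb s l : all (fun p => p.2 < n)%N s ->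
  lincomb total_coord s (Some l) = normalized l (lincomb x s).
Proof.
move=> sn; rewrite lincombE /normalized linear_lincomb mulr_sumr.
apply: eq_big_seq => p /(allP sn) pn /=.
by rewrite pn /GRing.scale /= mulrCA.
Qed.

Let sum_option (F : option 'I_N -> R) :
  \sum_o F o = F None + \sum_l F (Some l).
Proof.
rewrite (bigD1 None)//=; congr (_ + _).
rewrite (reindex_omap Some id)/=; last by case.
by apply: eq_bigl => l; rewrite eqxx.
Qed.

Let total_coord_le j o : sabs (total_coord j o) <= coord_radius j.
Proof.
have radius_ge0 := ltW (coord_radius_gt0 j).
case: o => [l|] /=; last by rewrite sabs0.
case: ifPn => jn; last by rewrite sabs0.
have [wl|wl] := eqVneq (w l) 0; first by rewrite /normalized q_null// mulr0 sabs0.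
rewrite -(@ler_pXn2r _ 2)// ?nnegrE ?sabs_ge0//.
rewrite sqr_sqrtr ?invr_ge0 ?(ltW (coord_weight_gt0 j))// -[leRHS]mul1r.
have wl_gt0 : 0 < w l by rewrite lt_neqAle eq_sym wl w_ge0.
rewrite ler_pdivlMr ?coord_weight_gt0// -(ler_pM2l wl_gt0) mulrA w_normalized.
by rewrite wl mul1r mulr1 mulrC term_le_w.
Qed.

Let total_coord_isometry s : all (fun p => p.2 < n)%N s ->
  \sum_o total_weight o * sabs (lincomb total_coord s o) ^+ 2 =
  rnorm (lincomb x s) ^+ 2.
Proof.
move=> sn; rewrite sum_option lincombE {1}/lincomb big1 => [|p _]; last first.
  exact: scaler0.
rewrite sabs0 expr0n mulr0 add0r -q_parseval//; apply: eq_bigr => l _.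
rewrite total_coord_lincomb// w_normalized.
have [wl|_] := eqVneq (w l) 0; last by rewrite mul1r.
rewrite linear_lincomb /lincomb big_seq big1 ?sabs0 ?expr0n ?mulr0//.
by move=> p /(allP sn) pn; rewrite /= q_null// scaler0.
Qed.

Let total_mult_coord_dist i j : (i < n)%N -> (j < n)%N ->
  \sum_o total_weight o *
    sabs (sofR k (total_mult o) * total_coord i o - total_coord j o) ^+ 2 <=
  rnorm (A (x i) - x j) ^+ 2.
Proof.
move=> ni nj; rewrite sum_option /= mulr0 subr0 sabs0 expr0n mulr0 add0r.
apply: le_trans (q_bessel _); apply: ler_sum => l _; rewrite ni nj.
have -> : sofR k (lam l) * normalized l (x i) - normalized l (x j) =
    normalized l (A (x i) - x j).
  by rewrite /normalized mulrCA q_mult// linearB mulrBr.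
by rewrite w_normalized; case: (w l != 0); rewrite ?mul1r// mul0r sqr_ge0.
Qed.

Let total_mult_second_moment :
  \sum_o total_weight o * total_mult o ^+ 2 <= 1.
Proof.
rewrite sum_option /= expr0n mulr0 add0r.
have -> : \sum_l w l * lam l ^+ 2 =
    \sum_(j < n) coord_weight j * \sum_l sabs (q l (A (x j))) ^+ 2.
  under eq_bigr do rewrite mulr_suml; rewrite exchange_big.
  apply: eq_bigr => j _; rewrite mulr_sumr; apply: eq_bigr => l _.
  rewrite -q_mult// sabsM sabs_sofR exprMn real_normK ?num_real//.
  by rewrite -mulrA (mulrC (lam l ^+ 2)).
apply: le_trans (sum_coord_weight_le1 n (b := fun j => rnorm (A (x j)) ^+ 2) _).
  by apply: ler_sum => j _; rewrite ler_wpM2l// ltW// coord_weight_gt0.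
by move=> j; rewrite lerDr addr_ge0// sqr_ge0.
Qed.

Lemma normalized_model : $| finite_model n |.
Proof.
have total_weight_ge0 o : 0 <= total_weight o.
  by case: o => [l|] /=; [exact: w_ge0|rewrite subr_ge0 w_sum].
have total_weight_sum : \sum_o total_weight o = 1 by rewrite sum_option subrK.
exact: (squash (FiniteModel total_weight_ge0 total_weight_sum total_coord_le
  total_coord_isometry total_mult_coord_dist total_mult_second_moment)).
Qed.

End normalization.

Lemma finite_model_ex (ip : {dot H for @sconj R k}) n :
  (forall y : H, `|y| ^+ 2 = ip y y) ->
  symmetric_operator ip A -> (forall i, dom A (x i)) -> $| finite_model n |.
Proof.
move=> ip_norm A_sym Dx.
have [N [lam [q [bessel parseval q_mult]]]] :=
  spectral_coordinates ip_norm n A_sym Dx.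
exact: normalized_model bessel parseval q_mult.
Qed.

End finite_model.

(** * Limits of finitely supported laws *)

Section interval_tree.
Variables (R : realType) (p : seq bool -> R).
Hypotheses (p_ge0 : forall s, 0 <= p s) (p_nil : p [::] = 1)
  (p_split : forall s, p s = p (false :: s) + p (true :: s)).

(* Words are read from right to left: the head of [s] is its last letter. The
   word [s] owns the interval of length [p s] starting at [tree_left s]. *)
Fixpoint tree_left (s : seq bool) : R :=
  if s is b :: s' then tree_left s' + (if b then p (false :: s') else 0) else 0.

Fixpoint tree_path (t : R) (n : nat) : seq bool :=
  if n is n'.+1 then
    let s := tree_path t n' in (tree_left s + p (false :: s) <= t) :: s
  else [::].

Lemma tree_path_eq t s : 0 <= t < 1 ->
  (tree_path t (size s) == s) = (tree_left s <= t < tree_left s + p s).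
Proof.
move=> t01; elim: s => [|b s IH]; first by rewrite eqxx /= p_nil add0r t01.
rewrite /= eqseq_cons.
case: (eqVneq (tree_path t (size s)) s) IH => [-> |_] /esym IH.
  rewrite andbT; move/andP: IH => [left_le lt_right].
  case: b => /=; rewrite ?addr0.
    by rewrite eqb_id -addrA -p_split lt_right andbT.
  by rewrite left_le /= ltNge eqbF_neg.
rewrite andbF; apply/esym; apply: contraFF IH => /= /andP[].
case: b => /=; rewrite ?addr0 => left_le lt_right.
  by rewrite (le_trans _ left_le) ?lerDl//= [p s]p_split addrA.
by rewrite left_le (lt_le_trans lt_right)// [p s]p_split addrA lerDl.
Qed.

Lemma tree_left_bounds s : 0 <= tree_left s /\ tree_left s + p s <= 1.
Proof.
elim: s => [|b s [left_ge0 right_le1]] /=; first by rewrite p_nil add0r.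
case: b => /=; rewrite ?addr0; split=> //.
- by rewrite addr_ge0.
- by rewrite -addrA -p_split.
- by rewrite (le_trans _ right_le1)// [p s]p_split addrA lerDl.
Qed.

End interval_tree.

Fixpoint rev_prefix (b : nat -> bool) (n : nat) : seq bool :=
  if n is m.+1 then b m :: rev_prefix b m else [::].

Lemma size_rev_prefix b n : size (rev_prefix b n) = n.
Proof. by elim: n => //= n ->. Qed.

Definition pad_word (s : seq bool) : cantor_space := nth false (rev s).

Lemma pad_rev_prefix b n i : (i < n)%N -> pad_word (rev_prefix b n) i = b i.
Proof.
rewrite /pad_word; elim: n => //= n IH.
rewrite rev_cons nth_rcons size_rev size_rev_prefix ltnS leq_eqVlt.
by case: ltngtP => //= [/IH|->].
Qed.

Lemma cvg_pad_rev_prefix (b : cantor_space) :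
  pad_word (rev_prefix c.1 c.2) @[c --> (b, \oo)] --> b.
Proof.
apply/pointwise_cvgP => i.
suff near_b : \forall c \near (b, \oo), c.1 i = b i /\ (i < c.2)%N.
  move=> B /nbhs_singleton Bbi; move: near_b; apply: filterS => -[c n] /= [ci ni].
  by rewrite /= pad_rev_prefix// ci.
exists ([set c : cantor_space | c i = b i], [set n | (i < n)%N]) => //=.
split; last exact: nbhs_infty_gt.
by have := @proj_continuous _ (fun=> bool) i b _ (discrete_set1 (b i)).
Qed.

(* Compactness of the Cantor space makes the approximation uniform. *)
Lemma cantor_approx_unif (R : realType) (F : cantor_space -> R) (e : R) :
  continuous F -> 0 < e ->
  \forall n \near \oo, forall b, `|F b - F (pad_word (rev_prefix b n))| <= e.
Proof.
move=> F_cont e0; pose P n b := `|F b - F (pad_word (rev_prefix b n))| <= e.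
have /compact_near_coveringP/(_ nat \oo P) := cantor_space_compact.
case=> [b _|n _ nP]; last by exists n => // m /nP h b; exact: h.
have /cvgrPdist_le/(_ (e / 2)) :
    F (pad_word (rev_prefix c.1 c.2)) @[c --> (b, \oo)] --> F b.
  exact: (cvg_comp _ _ (@cvg_pad_rev_prefix b) (F_cont b)).
have /cvgrPdist_le/(_ (e / 2)) : F c.1 @[c --> (b, \oo)] --> F b.
  exact: (cvg_comp fst F (@cvg_fst _ _ (nbhs b) \oo _) (F_cont b)).
have e20 : 0 < e / 2 by rewrite divr_gt0.
move=> /(_ e20) near1 /(_ e20) near2; apply: filterS2 near1 near2 => -[c n] /=.
rewrite /P distrC => h1 h2.
by rewrite (le_trans (ler_distD (F b) _ _))// [e]splitr lerD.
Qed.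

Lemma cantor_continuous_bounded (R : realType) (F : cantor_space -> R) :
  continuous F -> exists B, forall b, `|F b| <= B.
Proof.
move=> F_cont; have : compact (range F).
  apply: continuous_compact cantor_space_compact.
  exact: continuous_subspaceT.
move=> /compact_bounded[M [_ MP]]; exists (M + 1) => b.
by apply: MP; [rewrite ltrDl|exists b].
Qed.

Lemma cvg_ultra_segment (R : realType) (U : set_system nat) (u : nat -> R) a b :
  UltraFilter U -> (forall n, a <= u n <= b) -> exists l : R, u @ U --> l.
Proof.
move=> UU u_ab; have [l [_ lU]] : `[a, b]%classic `&` cluster (u @ U) !=set0.
  apply: (@segment_compact R a b); rewrite /fmap/=.
  by apply: (@filterE _ U) => n /=; rewrite in_itv /= u_ab.
exists l => B Bl; have [//|UB] := in_ultra_setVsetC (u @^-1` B) UU.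
by have [x []] := lU (~` B) B UB Bl.
Qed.

Section probability_integrals.
Context (R : realType) (d : measure_display) (T : measurableType d).
Variable P : probability T R.

Lemma bounded_integrable_prob (f : T -> R) (B : R) :
  measurable_fun setT f -> (forall w, `|f w| <= B) ->
  P.-integrable setT (EFin \o f).
Proof.
move=> mf fB; apply: measurable_bounded_integrable => //.
  by rewrite [X in (X < _)%E]probability_setT ltry.
by exists B; split=> [|M BM w _]; [exact: num_real|exact: le_trans (fB w) (ltW BM)].
Qed.

Lemma Rintegral_dist_le (f g : T -> R) (e : R) :
  P.-integrable setT (EFin \o f) -> P.-integrable setT (EFin \o g) ->
  (forall w, `|f w - g w| <= e) ->
  `|\int[P]_w f w - \int[P]_w g w| <= e.
Proof.
move=> If Ig fg; rewrite -RintegralB//.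
have Ifg : P.-integrable setT (EFin \o (f \- g)).
  exact: (integrableB measurableT If Ig).
rewrite (le_trans (le_normr_Rintegral measurableT Ifg))//.
have -> : e = \int[P]_w cst e w.
  by rewrite Rintegral_cst// [X in fine X]probability_setT mulr1.
apply: le_Rintegral => // [||w _]; last exact: fg.
  exact: integrable_norm.
exact: finite_measure_integrable_cst.
Qed.

End probability_integrals.

Definition uniform_variable (R : realType) d (T : measurableType d)
    (P : probability T R) (t : T -> R) :=
  [/\ measurable_fun setT t, forall w, 0 <= t w < 1 &
      forall a b, 0 <= a -> a <= b -> b <= 1 ->
        P [set w | a <= t w < b] = (b - a)%:E].

Section tree_measure.
Context (R : realType) (d : measure_display) (T : measurableType d).
Variables (P : probability T R) (t : T -> R) (t_unif : uniform_variable P t).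
Variable p : seq bool -> R.
Hypotheses (p_ge0 : forall s, 0 <= p s) (p_nil : p [::] = 1)
  (p_split : forall s, p s = p (false :: s) + p (true :: s)).

Definition tree_bits (w : T) : cantor_space :=
  fun i => head false (tree_path p (t w) i.+1).

Lemma rev_prefix_tree_bits w n :
  rev_prefix (tree_bits w) n = tree_path p (t w) n.
Proof. by elim: n => //= n ->. Qed.

Let cylinder s := [set w | tree_left p s <= t w < tree_left p s + p s].

Let measurable_cylinder s : measurable (cylinder s).
Proof.
have [mt _ _] := t_unif.
rewrite (_ : cylinder s =
  setT `&` t @^-1` `[tree_left p s, tree_left p s + p s[%classic).
  exact: mt.
by rewrite setTI; apply/seteqP; split=> w; rewrite /cylinder /= in_itv.
Qed.

Let cylinder_measure s : P (cylinder s) = (p s)%:E.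
Proof.
have [_ _ tP] := t_unif.
have [left_ge0 right_le1] := tree_left_bounds p_ge0 p_nil p_split s.
by rewrite /cylinder tP ?lerDl// addrAC subrr add0r.
Qed.

Let prefix_fun_indic (h : seq bool -> R) n w :
  h (rev_prefix (tree_bits w) n) =
  \sum_(s : n.-tuple bool) h s * \1_(cylinder s) w.
Proof.
have [_ t01 _] := t_unif.
have sz : size (rev_prefix (tree_bits w) n) == n by rewrite size_rev_prefix.
have cylE (s : n.-tuple bool) : (w \in cylinder s) = (s == Tuple sz).
  rewrite (_ : (w \in cylinder s) =
      (tree_left p s <= t w < tree_left p s + p s)).
    rewrite -(tree_path_eq p_ge0 p_nil p_split)// size_tuple.
    by rewrite -rev_prefix_tree_bits eq_sym.
  by apply/idP/idP => [/set_mem//|?]; exact/mem_set.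
rewrite (bigD1 (Tuple sz))// indicE cylE eqxx mulr1 big1 /= ?addr0// => s ns.
by rewrite indicE cylE (negbTE ns) mulr0.
Qed.

Lemma measurable_prefix_fun (h : seq bool -> R) n :
  measurable_fun setT (fun w => h (rev_prefix (tree_bits w) n)).
Proof.
under eq_fun do rewrite prefix_fun_indic.
apply: measurable_sum => s; apply: measurable_funM; first exact: measurable_cst.
exact/measurable_indic/measurable_cylinder.
Qed.

Lemma integral_prefix_fun (h : seq bool -> R) n :
  \int[P]_w h (rev_prefix (tree_bits w) n) =
  \sum_(s : n.-tuple bool) h s * p s.
Proof.
have int_term s : P.-integrable setT (fun w => (h s * \1_(cylinder s) w)%:E).
  under eq_fun do rewrite EFinM.
  by apply: integrableZl => //; exact: integrable_indic.
rewrite /Rintegral; under eq_integral do rewrite prefix_fun_indic -sumEFin.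
rewrite integral_sum// -[RHS]/(fine (_%:E)) -sumEFin; congr fine.
apply: eq_bigr => s _; under eq_integral do rewrite EFinM.
rewrite integralZl//; last exact: integrable_indic.
by rewrite integral_indic// setIT EFinM -cylinder_measure.
Qed.

End tree_measure.

Section law_limit.
Context (R : realType) (d : measure_display) (T : measurableType d).
Variable P : probability T R.
Variables (I : nat -> finType) (wt : forall n, I n -> R).
Hypotheses (wt_ge0 : forall n l, 0 <= @wt n l)
  (wt_sum : forall n, \sum_l @wt n l = 1).

Definition law_cvg (S : topologicalType) (z : forall n, I n -> S)
    (U : set_system nat) (X : T -> S) :=
  forall F : S -> R, continuous F ->
    P.-integrable setT (EFin \o (F \o X)) /\
    \sum_l wt l * F (@z n l) @[n --> U] --> \int[P]_w F (X w).

Section law_cvg_theory.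
Variables (S : topologicalType) (z : forall n, I n -> S) (X : T -> S).
Context (U : set_system nat) {PU : ProperFilter U}.
Hypothesis z_cvg : law_cvg z U X.

Lemma law_cvg_measurable (F : S -> R) :
  continuous F -> measurable_fun setT (F \o X).
Proof. by move=> /z_cvg[/integrableP[/measurable_EFinP]]. Qed.

Lemma law_cvg_le (F : S -> R) (C : R) : continuous F ->
  (\forall n \near U, \sum_l wt l * F (@z n l) <= C) ->
  (\int[P]_w (F (X w))%:E <= C%:E)%E.
Proof.
move=> /z_cvg[IF F_cvg] F_le.
rewrite -[leLHS]fineK ?integrable_fin_num// lee_fin.
exact: cvgr_to_le F_cvg F_le.
Qed.

Lemma law_cvg_eq (F : S -> R) (C : R) : continuous F ->
  (\forall n \near U, \sum_l wt l * F (@z n l) = C) ->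
  (\int[P]_w (F (X w))%:E = C%:E)%E.
Proof.
move=> /z_cvg[IF F_cvg] F_eq.
rewrite -[LHS]fineK ?integrable_fin_num//; congr EFin.
apply/le_anti; rewrite (cvgr_to_le F_cvg) ?(cvgr_to_ge F_cvg)//;
  by apply: filterS F_eq => n ->.
Qed.

End law_cvg_theory.

Variables (t : T -> R) (t_unif : uniform_variable P t).

Section cantor_law_limit.
Variable b : forall n, I n -> cantor_space.

Let prefix_law n (s : seq bool) : R :=
  \sum_l wt l * (rev_prefix (@b n l) (size s) == s)%:R.

Let prefix_law_bounds s n : 0 <= prefix_law n s <= 1.
Proof.
rewrite sumr_ge0 /= => [|l _]; last by rewrite mulr_ge0.
rewrite -(wt_sum n); apply: ler_sum => l _.
by case: eqP => _; rewrite ?mulr1// mulr0.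
Qed.

Let prefix_law_nil n : prefix_law n [::] = 1.
Proof. by rewrite -(wt_sum n); apply: eq_bigr => l _; rewrite eqxx mulr1. Qed.

Let prefix_law_split n s :
  prefix_law n s = prefix_law n (false :: s) + prefix_law n (true :: s).
Proof.
rewrite -big_split; apply: eq_bigr => l _ /=; rewrite -mulrDr; congr (_ * _).
rewrite !eqseq_cons.
by case: (b _ _); case: (_ == s); rewrite /= ?addr0 ?add0r.
Qed.

Let sum_prefix_law n N (h : seq bool -> R) :
  \sum_(s : N.-tuple bool) h s * prefix_law n s =
  \sum_l wt l * h (rev_prefix (@b n l) N).
Proof.
under eq_bigr do rewrite mulr_sumr.
rewrite exchange_big; apply: eq_bigr => l _ /=.
have sz : size (rev_prefix (b l) N) == N by rewrite size_rev_prefix.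
rewrite (bigD1 (Tuple sz))//= !size_rev_prefix eqxx mulr1 mulrC.
rewrite big1 ?addr0// => s ns.
rewrite size_tuple (_ : _ == _ = false) ?mulr0//.
by apply: contra_neqF ns => /eqP sE; apply: val_inj.
Qed.

Section prefix_limit.
Variables (U : set_system nat) (PU : ProperFilter U) (p : seq bool -> R).
Hypothesis prefix_cvg : forall s, prefix_law n s @[n --> U] --> p s.

Let p_ge0 s : 0 <= p s.
Proof.
apply: cvgr_to_ge (@prefix_cvg s) _.
by apply: nearW => n; case/andP: (prefix_law_bounds s n).
Qed.

Let p_nil : p [::] = 1.
Proof.
have cvg1 : prefix_law n [::] @[n --> U] --> (1 : R).
  by under eq_fun do rewrite prefix_law_nil; exact: cvg_cst.
by apply: (cvg_unique _ (@prefix_cvg [::]) cvg1); exact: norm_hausdorff.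
Qed.

Let p_split s : p s = p (false :: s) + p (true :: s).
Proof.
have cvg_split : prefix_law n s @[n --> U] --> p (false :: s) + p (true :: s).
  by under eq_fun do rewrite prefix_law_split; apply: cvgD; exact: prefix_cvg.
by apply: (cvg_unique _ (@prefix_cvg s) cvg_split); exact: norm_hausdorff.
Qed.

Let Z : T -> cantor_space := tree_bits t p.

Let prefix_fun_cvg (h : seq bool -> R) N :
  \sum_l wt l * h (rev_prefix (@b n l) N) @[n --> U] -->
  \int[P]_w h (rev_prefix (Z w) N).
Proof.
rewrite (integral_prefix_fun t_unif p_ge0 p_nil p_split).
under eq_fun do rewrite -sum_prefix_law.
apply: (cvg_big (@add_continuous _)) => s _.
by apply: cvgM; [exact: cvg_cst|exact: prefix_cvg].
Qed.

Lemma law_cvg_tree_bits : law_cvg b U Z.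
Proof.
move=> F F_cont; pose FN N (c : cantor_space) := F (pad_word (rev_prefix c N)).
have mFN N : measurable_fun setT (FN N \o Z).
  exact: (measurable_prefix_fun t_unif p_ge0 p_nil p_split (F \o pad_word)).
have mF : measurable_fun setT (F \o Z).
  apply: (measurable_fun_cvg mFN) => w _; apply/cvgrPdist_le => e e0.
  by apply: filterS (cantor_approx_unif F_cont e0) => n; apply.
have [B FB] := cantor_continuous_bounded F_cont.
have IF : P.-integrable setT (EFin \o (F \o Z)).
  by apply: (bounded_integrable_prob P mF) => w; exact: FB.
split=> //; apply/cvgrPdist_le => e e0.
have e30 : 0 < e / 3 by rewrite divr_gt0.
have [N _ /(_ N (leqnn N)) FN_close] := cantor_approx_unif F_cont e30.
have IFN : P.-integrable setT (EFin \o (FN N \o Z)).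
  by apply: (bounded_integrable_prob P (mFN N)) => w; exact: FB.
have int_close := Rintegral_dist_le IF IFN (fun w => FN_close (Z w)).
have sum_close n :
    `|\sum_l wt l * FN N (@b n l) - \sum_l wt l * F (@b n l)| <= e / 3.
  rewrite -sumrB (le_trans (ler_norm_sum _ _ _))//.
  rewrite -[leRHS]mul1r -[X in X * _](wt_sum n) mulr_suml; apply: ler_sum => l _.
  by rewrite -mulrBr normrM ger0_norm// ler_wpM2l// distrC.
have /cvgrPdist_le/(_ _ e30) := @prefix_fun_cvg (F \o pad_word) N.
apply: filterS => n cvg_close.
have -> : e = e / 3 + (e / 3 + e / 3) by field.
apply: (le_trans (ler_distD (\int[P]_w FN N (Z w)) _ _)); apply: lerD => //.
apply: (le_trans (ler_distD (\sum_l wt l * FN N (@b n l)) _ _)).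
exact: lerD.
Qed.

End prefix_limit.

Lemma cantor_law_limit : exists (Z : T -> cantor_space) (U : set_system nat),
  [/\ ProperFilter U, \oo `<=` U & law_cvg b U Z].
Proof.
have [U [UU oU]] := @ultraFilterLemma _ \oo _.
have PU : ProperFilter U by exact: ultra_proper.
have [p pP] := choice (fun s => cvg_ultra_segment UU (prefix_law_bounds s)).
by exists (tree_bits t p), U; split=> //; exact: law_cvg_tree_bits.
Qed.

End cantor_law_limit.

(* Every compact metric space is a continuous image of the Cantor space. *)
Theorem law_limit (S : pseudoPMetricType R) (z : forall n, I n -> S) :
  compact [set: S] -> hausdorff_space S ->
  exists (X : T -> S) (U : set_system nat),
  [/\ ProperFilter U, \oo `<=` U & law_cvg z U X].
Proof.
move=> S_compact S_hausdorff.
have [f f_cont] := cantor_surj S_compact S_hausdorff.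
have /choice[g gK] y : exists c, f c = y.
  by have [c _ <-] := 'surj_f (Logic.I : [set: S] y); exists c.
have [Z [U [PU oU ZP]]] := cantor_law_limit (fun n l => g (@z n l)).
exists (f \o Z), U; split=> // F F_cont.
have [|IF] := ZP (F \o f); first exact: continuousT_comp.
by under eq_fun do under eq_bigr do rewrite /= gK.
Qed.

End law_limit.

(** * The unit interval as a compact metric probability space *)

Section unit_interval.
Variable R : realType.

Record unit_itv := UnitItv { unit_val :> R; _ : 0 <= unit_val <= 1 }.
HB.instance Definition _ := [isSub for unit_val].
HB.instance Definition _ := [Choice of unit_itv by <:].

Let dist (x y : unit_itv) : R := `|unit_val x - unit_val y|.

Let distxx x : dist x x = 0. Proof. by rewrite /dist subrr normr0. Qed.

Let dist_eq0 x y : dist x y = 0 -> x = y.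
Proof. by move/normr0_eq0/eqP; rewrite subr_eq0 => /eqP; exact: val_inj. Qed.

Let dist_sym x y : dist x y = dist y x. Proof. exact: distrC. Qed.

Let dist_triangle y x z : dist x z <= dist x y + dist y z.
Proof. exact: ler_distD. Qed.

HB.instance Definition _ :=
  isMetric.Build R unit_itv distxx dist_eq0 dist_sym dist_triangle.

Let clamp_bounds (x : R) : 0 <= Num.max 0 (Num.min x 1) <= 1.
Proof. by rewrite le_max lexx /= ge_max ler01 ge_min lexx orbT. Qed.

Definition clamp (x : R) : unit_itv := UnitItv (clamp_bounds x).

HB.instance Definition _ := isPointed.Build unit_itv (clamp 0).

Lemma clampK (x : R) : 0 <= x <= 1 -> clamp x = x :> R.
Proof. by move=> /andP[x0 x1]; rewrite /= (min_idPl x1) (max_idPr x0). Qed.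

Lemma clamp_val (x : unit_itv) : clamp x = x.
Proof. by apply: val_inj; apply: clampK; case: x. Qed.

Lemma unit_val_continuous : continuous unit_val.
Proof.
move=> x; apply/(@cvgrPdist_lt _ _ _ _ (nbhs_filter x)) => e e0.
by apply/nbhs_ballP; exists e => //= y; rewrite ballEmdist.
Qed.

Lemma clamp_continuous : continuous clamp.
Proof.
move=> x; apply/cvg_ballP => e e0.
have clamp_cont : {for x, continuous (cst 0 \max (id \min cst 1) : R -> R^o)}.
  apply: continuous_max; first exact: cst_continuous.
  by apply: continuous_min => //; exact: cst_continuous.
have /cvgrPdist_lt/(_ e e0) := clamp_cont.
by apply: filterS => y; rewrite ballEmdist.
Qed.

Lemma unit_itv_compact : compact [set: unit_itv].
Proof.
rewrite (_ : setT = clamp @` `[0, 1]%classic).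
  apply: continuous_compact; last exact: segment_compact.
  by apply: continuous_subspaceT => x; exact: clamp_continuous.
apply/seteqP; split=> // x _; exists (unit_val x); last exact: clamp_val.
by rewrite /= in_itv; case: x.
Qed.

Lemma measurable_clamp :
  measurable_fun setT (clamp : R -> borelType unit_itv).
Proof.
apply: (@measurability _ _ _ (borelType unit_itv) setT clamp
  (@open unit_itv) erefl).
move=> _ [B oB <-]; rewrite setTI.
apply: open_measurable; apply: open_comp => // x _; exact: clamp_continuous.
Qed.

Lemma measurable_unit_val :
  measurable_fun setT (unit_val : borelType unit_itv -> R).
Proof.
apply: (@measurability _ _ (borelType unit_itv) R setT unit_val _
  (RGenOpens.measurableE R)) => _ [_ [a [b ->]] <-].
rewrite setTI; apply: sub_sigma_algebra.
apply: open_comp; last exact: interval_open.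
by move=> x _; exact: unit_val_continuous.
Qed.

Definition borel_clamp : measurableTypeR R -> borelType unit_itv := clamp.

HB.instance Definition _ := isMeasurableFun.Build _ _
  (measurableTypeR R) (borelType unit_itv) borel_clamp measurable_clamp.

Definition unit_measure : probability (borelType unit_itv) R :=
  distribution (uniform_prob (@ltr01 R)) borel_clamp.

(* [unit_measure] does not charge the point 1, which is moved to 0. *)
Definition unit_coord (w : borelType unit_itv) : R :=
  if unit_val w < 1 then unit_val w else 0.

Let unit_coord_bounds w : 0 <= unit_coord w < 1.
Proof.
rewrite /unit_coord; case: ifPn => [->|_]; last by rewrite lexx ltr01.
by case: w => ? /= /andP[->].
Qed.

Let measurable_unit_coord : measurable_fun setT unit_coord.
Proof.
apply: measurable_fun_ifT => //; last exact: measurable_unit_val.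
by apply: measurable_fun_ltr => //; exact: measurable_unit_val.
Qed.

Let unit_coord_clamp x : 0 <= x < 1 -> unit_coord (clamp x) = x.
Proof.
by move=> /andP[x0 x1]; rewrite /unit_coord clampK ?x1// x0 ltW.
Qed.

Let unit_coord_measure a b : 0 <= a -> a <= b -> b <= 1 ->
  unit_measure [set w | a <= unit_coord w < b] = (b - a)%:E.
Proof.
move=> a0 ab b1; set A := [set w | _].
have mA : measurable A.
  rewrite (_ : A = setT `&` unit_coord @^-1` `[a, b[%classic).
    exact: measurable_unit_coord.
  by rewrite setTI; apply/seteqP; split=> w; rewrite /A /= in_itv.
have mB : measurable (clamp @^-1` A).
  by rewrite -[X in measurable X]setTI; exact: measurable_clamp.
have itvE : lebesgue_measure (`[a, b[%classic : set R) = (b - a)%:E.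
  rewrite lebesgue_measure_itv /= lte_fin.
  by case: ltgtP ab => // -> _; rewrite subrr.
transitivity (\int[uniform_prob (@ltr01 R)]_x (\1_(clamp @^-1` A) x)%:E)%E.
  by rewrite integral_indic// setIT.
rewrite integral_uniform//; last exact/measurable_EFinP/measurable_indic.
rewrite subr0 invr1 mul1e integral_indic// -itvE.
apply/eqP; rewrite eq_le; apply/andP; split; last first.
  apply: le_measure; rewrite ?inE//; first exact: measurableI.
  move=> x; rewrite /= in_itv /= => /andP[ax xb].
  have x01 : 0 <= x < 1 by rewrite (le_trans a0)// (lt_le_trans xb).
  split; first by rewrite /A /= unit_coord_clamp// ax.
  by rewrite /= in_itv /=; case/andP: x01 => -> /ltW ->.
apply: (@le_trans _ _ (lebesgue_measure (`[a, b[%classic `|` [set 1 : R]))).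
  apply: le_measure; rewrite ?inE//; [exact: measurableI|exact: measurableU|].
  move=> x []; rewrite /A /= in_itv /= => h /andP[x0].
  rewrite le_eqVlt => /predU1P[->|x1]; first by right.
  by left; rewrite in_itv /= -[x]unit_coord_clamp ?x0.
apply: (le_trans (measureU2 _ _ _)) => //.
by rewrite [X in (_ + X)%E]lebesgue_measure_set1 adde0.
Qed.

Lemma unit_coord_uniform : uniform_variable unit_measure unit_coord.
Proof.
by split; [exact: measurable_unit_coord|exact: unit_coord_bounds|
  exact: unit_coord_measure].
Qed.

Definition signed_coord (y : unit_itv) : R := 2 * unit_val y - 1.

Lemma signed_coord_le1 y : `|signed_coord y| <= 1.
Proof.
case: y => y /= y01; rewrite /signed_coord /= ler_norml.
by case/andP: y01 => y0 y1; apply/andP; split; lra.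
Qed.

Lemma signed_coordK (r : R) :
  `|r| <= 1 -> signed_coord (clamp ((r + 1) / 2)) = r.
Proof.
rewrite ler_norml => /andP[r_ge r_le]; rewrite /signed_coord clampK; first by field.
by apply/andP; split; lra.
Qed.

Lemma signed_coord_continuous : continuous signed_coord.
Proof.
have affine_cont : continuous (fun r : R => 2 * r - 1).
  move=> r; apply: cvgB; last exact: cvg_cst.
  by apply: cvgM; [exact: cvg_cst|exact: cvg_id].
exact: (continuousT_comp unit_val_continuous affine_cont).
Qed.

End unit_interval.

Section cube.
Variables (R : realType) (V : countType).

Definition cube : Type := {ptws V -> unit_itv R}.
HB.instance Definition _ := Pointed.on cube.
HB.instance Definition _ := PseudoMetric.on cube.

Lemma cube_compact : compact [set: cube].
Proof.
have := @tychonoff V (fun=> unit_itv R) _ (fun=> @unit_itv_compact R).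
by congr (compact _); apply/seteqP; split.
Qed.

Lemma cube_hausdorff : hausdorff_space cube.
Proof. by apply: hausdorff_product => v; exact: metric_hausdorff. Qed.

Lemma cube_coord_continuous (v : V) : continuous (fun z : cube => z v).
Proof. exact: (@proj_continuous V (fun=> unit_itv R) v). Qed.

End cube.

Section scalar_continuity.
Variables (R : realType) (k : scalar_kind).
Local Notation K := (scalars R k).

Lemma sabs_lipschitz_continuous (f : K -> R) :
  (forall x y, `|f x - f y| <= sabs (x - y)) -> continuous f.
Proof.
move=> f_lip x; apply/(@cvgrPdist_lt _ _ _ _ (nbhs_filter x)) => e e0.
apply/nbhs_ballP; exists (sofR k e) => [|y] /=.
  by rewrite -(sofR0 R k) ltr_sofR.
by rewrite -ball_normE /= -sofR_sabs ltr_sofR; exact: le_lt_trans.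
Qed.

Lemma sabs_continuous : continuous (@sabs R k).
Proof.
by apply: sabs_lipschitz_continuous => x y; exact: (@rnorm_dist_dist R k K^o).
Qed.

Lemma sre_continuous : continuous (@sre R k).
Proof.
apply: sabs_lipschitz_continuous => x y.
by rewrite -raddfB; exact: normr_sre_le.
Qed.

Lemma sim_continuous : continuous (@sim R k).
Proof.
apply: sabs_lipschitz_continuous => x y.
by rewrite -raddfB; exact: normr_sim_le.
Qed.

Lemma sofR_continuous : continuous (@sofR R k).
Proof.
move=> x; apply/cvgrPdist_lt => e e0.
apply/nbhs_ballP; exists (sre e) => [|y] /=.
  by rewrite -(ltr_sofR k) sofR0 sofR_sre// ltW.
by rewrite /ball /= -rmorphB /= sofR_norm -(ltr_sofR k) (sofR_sre (ltW e0)).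
Qed.

Section scalar_functions.
Variable S : topologicalType.
Implicit Types (f g : S -> R) (F G : S -> K).

Lemma continuous_sabs_sqr F :
  continuous F -> continuous (fun z => sabs (F z) ^+ 2).
Proof.
move=> F_cont; have sabs_cont := continuousT_comp F_cont sabs_continuous.
exact: (continuousT_comp sabs_cont (@exprn_continuous R 2)).
Qed.

Lemma continuous_scaleR f F :
  continuous f -> continuous F -> continuous (fun z => sofR k (f z) * F z).
Proof.
move=> f_cont F_cont z; apply: cvgM; last exact: F_cont.
exact: (continuousT_comp f_cont sofR_continuous).
Qed.

Lemma continuous_sfunB F G :
  continuous F -> continuous G -> continuous (fun z => F z - G z).
Proof. by move=> F_cont G_cont z; apply: cvgB; [exact: F_cont|exact: G_cont]. Qed.

Lemma continuous_smk f g :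
  continuous f -> continuous g -> continuous (fun z => smk k (f z) (g z)).
Proof.
move=> f_cont g_cont; under eq_fun do rewrite smkE.
move=> z; apply: cvgD; first exact: (continuousT_comp f_cont sofR_continuous).
apply: cvgM; first exact: cvg_cst.
exact: (continuousT_comp g_cont sofR_continuous).
Qed.

Lemma continuous_lincomb (u : nat -> S -> K^o) s :
  (forall j, continuous (u j)) -> continuous (lincomb u s : S -> K).
Proof.
move=> u_cont.
have -> : lincomb u s = fun z => \sum_(p <- s) p.1 * u p.2 z.
  by apply/funext => z; rewrite lincombE.
move=> z; apply: (cvg_big (@add_continuous _)) => p _.
by apply: cvgM; [exact: cvg_cst|exact: u_cont].
Qed.

End scalar_functions.
End scalar_continuity.

(** * Square-integrable scalar functions *)

Section limits_of_functions.
Context (R : realType) (d : measure_display) (T : measurableType d).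
Variable mu : {measure set T -> \bar R}.
Local Open Scope ereal_scope.

Lemma fatou_bound (f : nat -> T -> \bar R) (g : T -> \bar R) (C : \bar R) :
  (forall n, measurable_fun setT (f n)) -> (forall n x, 0 <= f n x) ->
  measurable_fun setT g -> {ae mu, forall x, f n x @[n --> \oo] --> g x} ->
  (forall n, \int[mu]_x f n x <= C) -> \int[mu]_x g x <= C.
Proof.
move=> mf f0 mg fg fC.
rewrite (ae_eq_integral (fun x => limn_einf (f^~ x)))//.
- apply: (le_trans (@fatou _ _ _ mu _ measurableT f mf (fun n x _ => f0 n x))).
  rewrite limn_einf_lim; apply: lime_le; first exact: is_cvg_einfs.
  apply: nearW => n; apply: le_trans (fC n).
  by apply: ereal_inf_lbound; exists n => /=.
- rewrite (_ : (fun x => _) = fun x => - limn_esup (fun n => - f n x)).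
    apply: measurableT_comp => //; apply: measurable_fun_limn_esup => n.
    exact: measurableT_comp.
  by apply/funext => x; rewrite limn_esupN oppeK.
- by apply: filterS fg => x /cvg_limn_einf_sup[-> _].
Qed.

Lemma measurable_limit_ex (h : nat -> T -> R) :
  (forall n, measurable_fun setT (h n)) ->
  exists2 g : T -> R, measurable_fun setT g &
    forall x, cvgn (h^~ x) -> h n x @[n --> \oo] --> g x.
Proof.
move=> mh; exists (fun x => fine (limn_esup (fun n => (h n x)%:E))).
  apply: (measurableT_comp (@fine_measurable R setT measurableT)).
  by apply: measurable_fun_limn_esup => n; exact/measurable_EFinP.
move=> x hx; suff -> : limn_esup (fun n => (h n x)%:E) = (limn (h^~ x))%:E by [].
have /cvg_limn_einf_sup[_ //] : (h n x)%:E @[n --> \oo] --> (limn (h^~ x))%:E.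
by apply: cvg_EFin => //; exact: nearW.
Qed.

Lemma cvg_geometric_increments (h : nat -> R) (C : R) :
  (forall n, `|h n.+1 - h n| <= C * 2^-1 ^+ n)%R -> cvgn h.
Proof.
move=> hC.
have C0 : (0 <= C)%R by have := le_trans (normr_ge0 _) (hC 0%N); rewrite mulr1.
have half_norm : (`|2^-1 : R| < 1)%R.
  by rewrite ger0_norm ?invr_ge0// invf_lt1// ltr1n.
have cvg_series : cvgn (series (fun n => h n.+1 - h n)%R).
  apply: normed_cvg; apply: (@series_le_cvg _ _ (geometric C 2^-1)) => //.
  - by move=> n; exact: normr_ge0.
  - by move=> n; rewrite mulr_ge0// exprn_ge0// invr_ge0.
  - exact: is_cvg_geometric_series.
rewrite (_ : h = fun n => series (fun n => h n.+1 - h n) n + h 0%N)%R.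
  by apply: is_cvgD => //; exact: is_cvg_cst.
by apply/funext => n; rewrite /series /= telescope_sumr// subrK.
Qed.

Lemma ae_bounded_of_summable (f : nat -> T -> R) (C : R) :
  (forall r, measurable_fun setT (f r)) -> (forall r x, (0 <= f r x)%R) ->
  (forall n, \sum_(0 <= r < n) \int[mu]_x (f r x)%:E <= C%:E) ->
  {ae mu, forall x, exists B, forall r, (f r x <= B)%R}.
Proof.
move=> mf f0 int_f; have mfE r : measurable_fun setT (EFin \o f r).
  exact/measurable_EFinP.
pose S x : \bar R := \sum_(0 <= r <oo) (f r x)%:E.
have S0 x : 0 <= S x by apply: nneseries_ge0 => r _ _; rewrite lee_fin.
have mS : measurable_fun setT S.
  apply: (@ge0_emeasurable_sum _ _ _ setT (fun r => EFin \o f r) xpredT) => //.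
  by move=> r x _ _; rewrite /= lee_fin.
have int_S : \int[mu]_x S x <= C%:E.
  rewrite integral_nneseries//; last by move=> r x _; rewrite lee_fin.
  apply: lime_le; last exact: nearW.
  apply: is_cvg_nneseries => r _ _.
  by apply: integral_ge0 => x _; rewrite lee_fin.
have IS : mu.-integrable setT S.
  apply/integrableP; split=> //; under eq_integral do rewrite gee0_abs//.
  by rewrite (le_lt_trans int_S)// ltry.
apply: filterS (integrable_ae measurableT IS) => x /(_ Logic.I) Sx.
exists (fine (S x)) => r; rewrite -lee_fin fineK//.
apply: le_trans (nneseries_lim_ge r.+1 _); last by move=> n _ _; rewrite lee_fin.
by rewrite big_nat_recr//= leeDr// sume_ge0// => i _; rewrite lee_fin.
Qed.

Lemma ae_geometric_bound (g : nat -> T -> R) :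
  (forall r, measurable_fun setT (g r)) ->
  (forall r, \int[mu]_x (g r x ^+ 2)%:E <= (16^-1 ^+ r)%:E) ->
  {ae mu, forall x, exists C, forall r, (`|g r x| <= C * 2^-1 ^+ r)%R}.
Proof.
move=> mg gr; have mg2 r : measurable_fun setT (fun x => g r x ^+ 2)%R.
  exact: measurable_funX.
have int_term r : \int[mu]_x (4 ^+ r * g r x ^+ 2)%:E <= (4^-1 ^+ r)%:E.
  under eq_integral do rewrite EFinM; rewrite ge0_integralZl_EFin//; last 2 first.
  - by move=> x _; rewrite lee_fin sqr_ge0.
  - exact/measurable_EFinP.
  apply: (@le_trans _ _ ((4 ^+ r)%:E * (16^-1 ^+ r)%:E)).
    by rewrite lee_pmul2l ?lte_fin ?exprn_gt0//; exact: gr.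
  by rewrite -EFinM lee_fin -exprMn (_ : 4 / 16 = 4^-1 :> R)%R//; lra.
have := @ae_bounded_of_summable (fun r x => 4 ^+ r * g r x ^+ 2)%R
  (1 * (1 - 4^-1)^-1).
case=> [r|r x|n|N [mN N0 NP]].
- exact: measurable_funM.
- by apply: mulr_ge0; [exact: exprn_ge0|exact: sqr_ge0].
- apply: (@le_trans _ _ (\sum_(0 <= r < n) (4^-1 ^+ r)%:E)); first exact: lee_sum.
  rewrite sumEFin lee_fin; under eq_bigr do rewrite -[(_ ^+ _)%R]mul1r.
  apply: (@geometric_le_lim _ n 1%R 4^-1%R); rewrite ?invr_gt0//.
  by rewrite gtr0_norm ?invr_gt0// invf_lt1// ltr1n.
exists N; split=> // x Nx; apply: NP => -[B B_bound]; apply: Nx.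
exists (Num.sqrt B) => r; have B0 : (0 <= B)%R.
  by apply: le_trans (B_bound 0%N); rewrite mul1r sqr_ge0.
rewrite -(@ler_pXn2r _ 2) ?nnegrE ?mulr_ge0 ?sqrtr_ge0 ?exprn_ge0 ?invr_ge0//.
rewrite real_normK ?num_real// exprMn sqr_sqrtr// exprAC exprVn.
rewrite (_ : 2 ^+ 2 = 4 :> R)%R; last by rewrite expr2; lra.
by rewrite exprVn ler_pdivlMr ?exprn_gt0// mulrC; exact: B_bound.
Qed.

End limits_of_functions.

Section square_integral.
Context (R : realType) (k : scalar_kind) (d : measure_display).
Context (T : measurableType d).
Variable mu : {measure set T -> \bar R}.
Local Notation K := (scalars R k).
Local Notation L := (L2 k mu).
Implicit Types f g : T -> K^o.

Lemma measurable_sfunB f g : measurable_sfun f -> measurable_sfun g ->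
  measurable_sfun (f - g).
Proof.
move=> mf mg; apply: measurable_sfunD => //.
rewrite (_ : (- g) = fun x => -1 * g x); last first.
  by apply/funext => x; rewrite mulN1r.
by apply: measurable_sfunM => //; exact: measurable_sfun_cst.
Qed.

Lemma measurable_sabs_sqr f :
  measurable_sfun f -> measurable_fun setT (fun x => sabs (f x) ^+ 2).
Proof. by move=> mf; apply: measurable_funX; exact: measurable_sabs. Qed.

Definition sqint f : \bar R := (\int[mu]_x (sabs (f x) ^+ 2)%:E)%E.

Lemma Lnorm2_sqint f :
  ('N[mu]_(2%:E) [EFin \o (sabs \o f)] `^ 2 = sqint f)%E.
Proof.
rewrite poweR_Lnorm//; apply: eq_integral => x _ /=.
by rewrite powR_mulrn// ger0_norm// sabs_ge0.
Qed.

Lemma L2fun_sqint f :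
  measurable_sfun f -> (sqint f < +oo)%E -> f \in L2fun k mu.
Proof.
move=> mf fi; apply/L2funP; split=> //; rewrite /finite_norm ltey.
by apply: contraTN fi => /eqP fy; rewrite -Lnorm2_sqint fy poweRyr ?ltxx.
Qed.

Lemma measurable_L2fun f : f \in L2fun k mu -> measurable_sfun f.
Proof. by case/L2funP. Qed.

Lemma rnorm_L2 (F : L) : rnorm F = L2_norm F.
Proof. exact: sre_sofR. Qed.

(* The class of [f] when [f \in L2fun k mu], and 0 otherwise. *)
Definition L2_class f : L := \pi_L%qT (insubd (0 : L2fun_type k mu) f).

Lemma L2_classE f (Lf : f \in L2fun k mu) : L2_class f = \pi_L%qT (MkL2fun Lf).
Proof.
congr (\pi_L%qT _); apply: val_inj.
exact: (@insubdK _ _ (L2fun_type k mu) 0 f Lf).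
Qed.

Lemma L2_class_surj (F : L) : exists2 f, f \in L2fun k mu & F = L2_class f.
Proof.
have Lf := valP (repr F : L2fun_type k mu).
exists (repr F : L2fun_type k mu) => //; rewrite (L2_classE Lf) -[LHS]reprK.
by congr (\pi_L%qT _); exact: val_inj.
Qed.

Lemma rnorm_L2_class f :
  f \in L2fun k mu -> ((rnorm (L2_class f) ^+ 2)%:E = sqint f)%E.
Proof.
move=> Lf; have /L2funP[_ f_fin] := Lf.
rewrite rnorm_L2 (L2_classE Lf) L2_norm_pi -Lnorm2_sqint /=.
rewrite -[in RHS](@fineK _ ('N[mu]_(2%:E)[_])) ?ge0_fin_numE ?Lnorm_ge0//.
by rewrite poweR_EFin powR_mulrn// fine_ge0// Lnorm_ge0.
Qed.

Lemma L2_class_eq f g : f \in L2fun k mu -> g \in L2fun k mu ->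
  L2_class f = L2_class g <-> f = g %[ae mu].
Proof. by move=> Lf Lg; rewrite (L2_classE Lf) (L2_classE Lg); exact: L2_eqP. Qed.

Lemma L2_classD f g : f \in L2fun k mu -> g \in L2fun k mu ->
  L2_class (f + g) = L2_class f + L2_class g.
Proof.
move=> Lf Lg; rewrite (L2_classE Lf) (L2_classE Lg) -pi_L2D.
rewrite (L2_classE (rpredD Lf Lg)).
by congr (\pi_L%qT _); exact: val_inj.
Qed.

Lemma L2_classZ (a : K) f :
  f \in L2fun k mu -> L2_class (a *: f) = a *: L2_class f.
Proof.
move=> Lf; rewrite (L2_classE Lf) -pi_L2Z (L2_classE (rpredZ a Lf)).
by congr (\pi_L%qT _); exact: val_inj.
Qed.

Lemma L2_classB f g : f \in L2fun k mu -> g \in L2fun k mu ->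
  L2_class (f - g) = L2_class f - L2_class g.
Proof.
move=> Lf Lg; rewrite -[- g]scaleN1r -[- L2_class g]scaleN1r.
by rewrite L2_classD ?L2_classZ// rpredZ.
Qed.

Lemma L2_class_lincomb (u : nat -> T -> K^o) s :
  (forall j, u j \in L2fun k mu) ->
  L2_class (lincomb u s) = lincomb (L2_class \o u) s.
Proof.
move=> Lu; pose P f F := f \in L2fun k mu /\ L2_class f = F.
suff [] : P (lincomb u s) (lincomb (L2_class \o u) s) by [].
apply: (big_ind2 P) => [|f F g G [Lf <-] [Lg <-]|p _].
- split; first exact: rpred0.
  by rewrite -(scale0r (u 0%N)) L2_classZ ?scale0r.
- by split; [exact: rpredD|rewrite L2_classD].
- by split; [exact: rpredZ|rewrite L2_classZ].
Qed.

Lemma rnorm_L2Z (a : K) (F : L) : rnorm (a *: F) = sabs a * rnorm F.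
Proof.
rewrite !rnorm_L2; elim/quotW: F => f; rewrite -pi_L2Z !L2_norm_pi.
have -> : L2fun_val (a *: f) = (fun w => a * f w) by [].
rewrite (Lnorm2_scale a (valP f)) fineM// ge0_fin_numE ?Lnorm_ge0//.
by case/L2funP: (valP f).
Qed.

Lemma ae_eq_sqint f g : measurable_sfun f -> measurable_sfun g ->
  f = g %[ae mu] -> sqint f = sqint g.
Proof.
move=> mf mg fg; apply: ae_eq_integral => //.
- exact/measurable_EFinP/measurable_sabs_sqr.
- exact/measurable_EFinP/measurable_sabs_sqr.
- by apply: filterS fg => x /= h Tx; rewrite h.
Qed.

Lemma le_sqint f g : measurable_sfun f -> measurable_sfun g ->
  (forall x, sabs (f x) <= sabs (g x)) -> (sqint f <= sqint g)%E.
Proof.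
move=> mf mg fg; apply: ge0_le_integral => //.
- by move=> x _; rewrite lee_fin sqr_ge0.
- exact/measurable_EFinP/measurable_sabs_sqr.
- exact/measurable_EFinP/measurable_sabs_sqr.
- by move=> x _; rewrite lee_fin ler_pXn2r ?nnegrE ?sabs_ge0.
Qed.

Lemma measurable_sfun_limit_ex (f : nat -> T -> K^o) :
  (forall n, measurable_sfun (f n)) ->
  exists2 g : T -> K^o, measurable_sfun g & forall x,
    cvgn (fun n => sre (f n x)) -> cvgn (fun n => sim (f n x)) ->
    forall c, sabs (f n x - c) ^+ 2 @[n --> \oo] --> sabs (g x - c) ^+ 2.
Proof.
move=> mf.
have [gr mgr gr_lim] := measurable_limit_ex (fun n => (mf n).1).
have [gi mgi gi_lim] := measurable_limit_ex (fun n => (mf n).2).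
pose g x : K := smk k (gr x) (gi x).
have sim_g : sim \o g = if k is ComplexScalars then gi else cst 0.
  by apply/funext => x; rewrite /= sim_smk; case: (k).
exists g.
  split.
    by rewrite (_ : _ \o _ = gr)//; apply/funext => x /=; rewrite sre_smk.
  by rewrite sim_g; case: (k).
move=> x /gr_lim cvg_re /gi_lim cvg_im c.
have {}cvg_im : sim (f n x) @[n --> \oo] --> sim (g x).
  rewrite -[sim (g x)]/((sim \o g) x) sim_g.
  move: {sim_g g} f mf cvg_im {gr_lim cvg_re gi_lim} c.
  by case: (k) => // f _ _ _; exact: cvg_cst.
rewrite sabs_sqr; under eq_fun do rewrite sabs_sqr.
rewrite !raddfB /= sre_smk !expr2.
under eq_fun do rewrite !raddfB /= !expr2.
have cvg_reB : sre (f n x) - sre c @[n --> \oo] --> gr x - sre c.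
  by apply: cvgB => //; exact: cvg_cst.
have cvg_imB : sim (f n x) - sim c @[n --> \oo] --> sim (g x) - sim c.
  by apply: cvgB => //; exact: cvg_cst.
by apply: cvgD; apply: cvgM.
Qed.

Theorem rapidly_cauchy_sqint_limit (f : nat -> T -> K^o) :
  (forall r, measurable_sfun (f r)) ->
  (forall r s, (r <= s)%N -> (sqint (f s - f r)%R <= (16^-1 ^+ r)%:E)%E) ->
  exists2 g : T -> K^o, measurable_sfun g &
    forall r, (sqint (g - f r)%R <= (16^-1 ^+ r)%:E)%E.
Proof.
move=> mf f_cauchy; have [g mg g_lim] := measurable_sfun_limit_ex mf.
exists g => // r.
apply: (fatou_bound (mu := mu)
  (f := fun s x => (sabs ((f (s + r)%N - f r) x) ^+ 2)%:E)).
- by move=> s; exact/measurable_EFinP/measurable_sabs_sqr/measurable_sfunB.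
- by move=> s x; rewrite lee_fin sqr_ge0.
- exact/measurable_EFinP/measurable_sabs_sqr/measurable_sfunB.
- have := @ae_geometric_bound _ _ _ mu (fun r x => sabs ((f r.+1 - f r) x)).
  case=> [s|s|N [mN N0 NP]].
  + exact/measurable_sabs/measurable_sfunB.
  + exact/f_cauchy/leqnSn.
  exists N; split=> // x Nx; apply: NP => -[C C_bound]; apply: Nx.
  apply: cvg_EFin; first exact: nearW.
  rewrite (cvg_shiftn r (fun s => sabs (f s x - f r x) ^+ 2)).
  apply: g_lim; apply: (@cvg_geometric_increments _ _ C) => s;
    apply: le_trans (C_bound s); rewrite -raddfB [leRHS]ger0_norm ?sabs_ge0//.
    exact: normr_sre_le.
  exact: normr_sim_le.
- by move=> s; apply: f_cauchy; rewrite leq_addl.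
Qed.

Corollary rapidly_cauchy_L2_limit (F : nat -> L) :
  (forall r s, (r <= s)%N -> rnorm (F s - F r) <= 4^-1 ^+ r) ->
  exists G : L, forall r, rnorm (G - F r) <= 4^-1 ^+ r.
Proof.
move=> F_cauchy.
have sqr_le (G : L) r :
    ((rnorm G ^+ 2)%:E <= (16^-1 ^+ r)%:E)%E = (rnorm G <= 4^-1 ^+ r).
  rewrite lee_fin (_ : 16^-1 = 4^-1 ^+ 2 :> R); last by rewrite expr2; lra.
  by rewrite exprAC ler_pXn2r ?nnegrE ?rnorm_ge0// exprn_ge0// invr_ge0.
have /choice[f fP] r : exists f, f \in L2fun k mu /\ F r = L2_class f.
  by have [f Lf Fr] := L2_class_surj (F r); exists f.
have Lf r := (fP r).1; have mf r := measurable_L2fun (Lf r).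
have [r s rs|g mg g_lim] := rapidly_cauchy_sqint_limit mf.
  by rewrite -rnorm_L2_class ?rpredB// L2_classB// -!(fP _).2 sqr_le F_cauchy.
have Lgf r : g - f r \in L2fun k mu.
  apply: L2fun_sqint; first exact: measurable_sfunB.
  by rewrite (le_lt_trans (g_lim r))// ltry.
have Lg : g \in L2fun k mu by rewrite -[g](subrK (f 0%N)) rpredD.
by exists (L2_class g) => r; rewrite -sqr_le (fP r).2 -L2_classB// rnorm_L2_class.
Qed.

End square_integral.

(** * Multiplication operators *)

Section multiplication.
Context (R : realType) (k : scalar_kind) (d : measure_display).
Context (T : measurableType d).
Variable mu : {measure set T -> \bar R}.
Local Notation K := (scalars R k).
Local Notation L := (L2 k mu).

Lemma measurable_smul (m : {mfun T >-> R}) (f : T -> K^o) :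
  measurable_sfun f -> measurable_sfun (smul m f).
Proof.
by move=> mf; apply: measurable_sfunM => //; exact: measurable_sfun_sofR.
Qed.

Lemma dom_mulop_L2_class (m : {mfun T >-> R}) (f : T -> K^o) :
  f \in L2fun k mu -> dom (mulop k mu m) (L2_class mu f) <->
  smul m f \in L2fun k mu.
Proof. by move=> Lf; rewrite (L2_classE Lf); exact: mulop_domP. Qed.

Lemma mulop_L2_class (m : {mfun T >-> R}) (f : T -> K^o) :
  f \in L2fun k mu -> smul m f \in L2fun k mu ->
  mulop k mu m (L2_class mu f) = L2_class mu (smul m f).
Proof.
by move=> Lf Lmf; rewrite (L2_classE Lf) (L2_classE Lmf); exact: mulop_funP.
Qed.

Section contraction.
Variable m : {mfun T >-> R}.
Hypothesis m1 : forall w, `|m w| <= 1.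

Let sqint_smul_le (f : T -> K^o) :
  measurable_sfun f -> (sqint mu (smul m f) <= sqint mu f)%E.
Proof.
move=> mf; apply: le_sqint => [||w]; [exact: measurable_smul|exact: mf|].
by rewrite /smul sabsM sabs_sofR ler_piMl ?sabs_ge0.
Qed.

Lemma smul_L2fun (f : T -> K^o) : f \in L2fun k mu -> smul m f \in L2fun k mu.
Proof.
move=> Lf; have mf := measurable_L2fun Lf.
apply: L2fun_sqint; first exact: measurable_smul.
by rewrite (le_lt_trans (sqint_smul_le mf))// -rnorm_L2_class// ltry.
Qed.

Lemma dom_mulop_contraction (F : L) : dom (mulop k mu m) F.
Proof.
by have [f Lf ->] := L2_class_surj F; apply/dom_mulop_L2_class/smul_L2fun.
Qed.

Lemma rnorm_mulop_le (F : L) : rnorm (mulop k mu m F) <= rnorm F.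
Proof.
have [f Lf ->] := L2_class_surj F; have Lmf := smul_L2fun Lf.
rewrite mulop_L2_class// -(@ler_pXn2r _ 2) ?nnegrE ?rnorm_ge0//.
rewrite -lee_fin !rnorm_L2_class//.
exact: (sqint_smul_le (measurable_L2fun Lf)).
Qed.

End contraction.

Lemma mulop_divide (m y rho : {mfun T >-> R}) (F G : L) :
  {ae mu, forall w, rho w != 0 /\ m w * rho w = y w} ->
  dom (mulop k mu y) F -> dom (mulop k mu rho) G ->
  mulop k mu y F = mulop k mu rho G ->
  dom (mulop k mu m) F /\ mulop k mu m F = G.
Proof.
have [f Lf ->] := L2_class_surj F; have [g Lg ->] := L2_class_surj G.
move=> rhoP /(dom_mulop_L2_class _ Lf) Lyf /(dom_mulop_L2_class _ Lg) Lrg.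
rewrite (mulop_L2_class Lf Lyf) (mulop_L2_class Lg Lrg).
move=> /(L2_class_eq Lyf Lrg) yf_rg.
have mf_g : smul m f = g %[ae mu].
  apply: filterS2 rhoP yf_rg => w [rho0 mrho] /[apply] /=.
  rewrite /smul -mrho (mulrC (m w)) rmorphM /= -mulrA => /mulfI; apply.
  by rewrite -(sofR0 R k) (inj_eq (@sofR_inj R k)).
have mmf := measurable_smul m (measurable_L2fun Lf).
have Lmf : smul m f \in L2fun k mu.
  apply: L2fun_sqint => //.
  by rewrite (ae_eq_sqint mmf (measurable_L2fun Lg) mf_g) -rnorm_L2_class// ltry.
split; first exact: ((dom_mulop_L2_class m Lf).2 Lmf).
exact: (etrans (mulop_L2_class Lf Lmf) ((L2_class_eq Lmf Lg).2 mf_g)).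
Qed.

End multiplication.

(** * The bounded transform of the multiplier *)

Section bounded_transform.
Variable R : realType.
Implicit Types a y : R.

Definition bounded_transform a : R := a / (1 + `|a|).

(* The inverse transform on [`|y| < 1]; 0 at [`|y| = 1]. *)
Definition unbounded_transform y : R := y / (1 - `|y|).

Let denom_gt0 a : 0 < 1 + `|a|. Proof. by rewrite ltr_pwDl. Qed.

Lemma normr_bounded_transform a : `|bounded_transform a| = 1 - (1 + `|a|)^-1.
Proof.
rewrite normrM normfV (gtr0_norm (denom_gt0 a)).
by field; rewrite gt_eqF.
Qed.

Lemma bounded_transform_lt1 a : `|bounded_transform a| < 1.
Proof. by rewrite normr_bounded_transform ltrBlDr ltrDl invr_gt0. Qed.

Lemma bounded_transformK : cancel bounded_transform unbounded_transform.
Proof.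
move=> a; rewrite /unbounded_transform normr_bounded_transform subKr invrK.
by rewrite divfK// gt_eqF.
Qed.

(* Bounded continuous functions increasing to the square of
   [unbounded_transform y], and to infinity at [`|y| = 1]. *)
Definition cutoff_square (n : nat) y : R :=
  y ^+ 2 / ((1 - `|y|) ^+ 2 + n.+1%:R^-1).

Let cutoff_denom_gt0 n y : 0 < (1 - `|y|) ^+ 2 + n.+1%:R^-1 :> R.
Proof. by rewrite ltr_wpDl ?sqr_ge0// invr_gt0. Qed.

Lemma cutoff_square_ge0 n y : 0 <= cutoff_square n y.
Proof. by rewrite divr_ge0 ?sqr_ge0// ltW// cutoff_denom_gt0. Qed.

Lemma cutoff_square_continuous n : continuous (cutoff_square n).
Proof.
have sqr_cont (f : R -> R) : continuous f -> continuous (fun r => f r ^+ 2).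
  by move=> f_cont; exact: (continuousT_comp f_cont (@exprn_continuous R 2)).
have rho_cont : continuous (fun r : R => 1 - `|r|).
  by move=> r; apply: cvgB; [exact: cvg_cst|exact: norm_continuous].
move=> y; apply: cvgM; first exact: exprn_continuous.
apply: cvgV; first by rewrite gt_eqF.
by apply: cvgD; [exact: (sqr_cont _ rho_cont y)|exact: cvg_cst].
Qed.

Lemma cutoff_square_le n y :
  `|y| < 1 -> cutoff_square n y <= unbounded_transform y ^+ 2.
Proof.
move=> y1; rewrite /unbounded_transform expr_div_n ler_wpM2l ?sqr_ge0//.
have d0 : 0 < (1 - `|y|) ^+ 2 by rewrite exprn_gt0// subr_gt0.
by rewrite lef_pV2 ?posrE ?cutoff_denom_gt0// lerDl invr_ge0.
Qed.

Lemma cvg_cutoff_square y : `|y| < 1 ->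
  cutoff_square n y @[n --> \oo] --> unbounded_transform y ^+ 2.
Proof.
move=> y1; rewrite /unbounded_transform expr_div_n; apply: cvgM.
  exact: cvg_cst.
rewrite -[in X in _ --> X](addr0 ((1 - `|y|) ^+ 2)).
apply: cvgV; first by rewrite addr0 gt_eqF// exprn_gt0// subr_gt0.
by apply: cvgD; [exact: cvg_cst|exact: cvg_harmonic].
Qed.

Lemma cutoff_square_norm1 n y : `|y| = 1 -> cutoff_square n y = n.+1%:R.
Proof.
move=> y1; rewrite /cutoff_square -(real_normK (num_real y)) y1.
by rewrite subrr expr0n expr1n add0r invrK mul1r.
Qed.

Section second_moment.
Context (d : measure_display) (T : measurableType d).
Variables (mu : {measure set T -> \bar R}) (y : T -> R).
Hypotheses (my : measurable_fun setT y) (y1 : forall w, `|y w| <= 1).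

Lemma measurable_unbounded_transform :
  measurable_fun setT (unbounded_transform \o y).
Proof.
rewrite (_ : _ \o _ = fun w => y w * (1 - `|y w|) `^ -1); last first.
  by apply/funext => w /=; rewrite powR_inv1// subr_ge0.
apply: measurable_funM => //.
apply: (measurableT_comp (measurable_powR (-1))).
by apply: measurable_funB => //; exact: measurableT_comp.
Qed.

Lemma cutoff_square_moment (C : R) :
  (forall n, \int[mu]_w (cutoff_square n (y w))%:E <= C%:E)%E ->
  {ae mu, forall w, `|y w| < 1} /\
  (\int[mu]_w (unbounded_transform (y w) ^+ 2)%:E <= C%:E)%E.
Proof.
move=> cutoff_le.
pose f n w := (cutoff_square n (y w))%:E.
have mf n : measurable_fun setT (f n).
  apply/measurable_EFinP; apply: (measurableT_comp (f := cutoff_square n)) my.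
  by apply: continuous_measurable_fun; exact: cutoff_square_continuous.
have f0 n w : (0 <= f n w)%E by rewrite lee_fin cutoff_square_ge0.
pose g w : \bar R :=
  if `|y w| < 1 then (unbounded_transform (y w) ^+ 2)%:E else +oo%E.
have f_cvg w : f n w @[n --> \oo] --> g w.
  rewrite /g; case: ltP => yw.
    by apply: cvg_EFin; [exact: nearW|exact: cvg_cutoff_square].
  have {}yw : `|y w| = 1 by apply/le_anti; rewrite y1.
  rewrite /f; under eq_fun do rewrite cutoff_square_norm1//.
  apply/cvgeryP; rewrite (cvg_shiftS (fun n => n%:R : R)); exact: cvgr_idn.
have mg : measurable_fun setT g by exact: (emeasurable_fun_cvg f).
have int_g : (\int[mu]_w g w <= C%:E)%E.
  by apply: (fatou_bound mf f0 mg) => //; exact: aeW.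
have g0 w : (0 <= g w)%E by rewrite /g; case: ltP => // _; rewrite lee_fin sqr_ge0.
have Ig : mu.-integrable setT g.
  apply/integrableP; split=> //; under eq_integral do rewrite gee0_abs//.
  by rewrite (le_lt_trans int_g)// ltry.
split.
  apply: filterS (integrable_ae measurableT Ig) => w /(_ Logic.I).
  by rewrite /g; case: ltP.
apply: le_trans int_g; apply: ge0_le_integral => //.
- by move=> w _; rewrite lee_fin sqr_ge0.
- exact/measurable_EFinP/measurable_funX/measurable_unbounded_transform.
- by move=> w _; rewrite /g; case: ltP => // _; exact: leey.
Qed.

End second_moment.
End bounded_transform.

(** * The limit model *)

Section limit_model.
Variables (R : realType) (k : scalar_kind).
Local Notation K := (scalars R k).
Variables (H : normedModType K) (A : operator H) (x : nat -> H).
Variable M : forall n, finite_model A x n.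
Context (d : measure_display) (T : measurableType d).
Variables (P : probability T R) (t : T -> R) (t_unif : uniform_variable P t).

(* Coordinates of the compactified model: [None] carries the bounded transform
   of the multiplier, [Some (j, b)] the real or imaginary part of the [j]-th
   function, rescaled by its bound. *)
Local Notation V := (option (nat * bool)).
Local Notation radius := (coord_radius A x).

Let Y (z : cube R V) : R := signed_coord (z None).

Let u (j : nat) (z : cube R V) : K^o :=
  smk k (radius j * signed_coord (z (Some (j, true))))
        (radius j * signed_coord (z (Some (j, false)))).

Let z n (l : model_atom (M n)) : cube R V := fun v =>
  clamp ((match v with
          | None => bounded_transform (model_mult l)
          | Some (j, true) => sre (model_coord j l) / radius j
          | Some (j, false) => sim (model_coord j l) / radius j
          end + 1) / 2).

Let Y_z n (l : model_atom (M n)) : Y (z l) = bounded_transform (model_mult l).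
Proof. by rewrite /Y signed_coordK// ltW// bounded_transform_lt1. Qed.

Let u_z n (l : model_atom (M n)) j : u j (z l) = model_coord j l.
Proof.
have radius0 := coord_radius_gt0 A x j.
have radiusK (r : R) : `|r| <= sabs (model_coord j l) ->
    radius j * signed_coord (clamp ((r / radius j + 1) / 2)) = r.
  move=> r_le; rewrite signed_coordK; first by rewrite mulrC divfK// gt_eqF.
  rewrite normrM normfV (gtr0_norm radius0) ler_pdivrMr// mul1r.
  exact: (le_trans r_le (model_coord_le _ _)).
rewrite /u !radiusK ?smk_eta//; [exact: normr_sim_le|exact: normr_sre_le].
Qed.

Let signed_coord_at_continuous v :
  continuous (fun z : cube R V => signed_coord (z v)).
Proof.
exact: (continuousT_comp (@cube_coord_continuous R V v)
  (@signed_coord_continuous R)).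
Qed.

Let Y_continuous : continuous Y.
Proof. exact: signed_coord_at_continuous. Qed.

Let u_continuous j : continuous (u j).
Proof.
apply: continuous_smk; apply: (continuousT_comp _ (@mulrl_continuous R _));
  exact: signed_coord_at_continuous.
Qed.

Let rho (r : R) : R := 1 - `|r|.

Let rho_continuous : continuous (rho \o Y).
Proof.
apply: (continuousT_comp Y_continuous) => r.
by apply: cvgB; [exact: cvg_cst|exact: norm_continuous].
Qed.

Let mult_dist n (l : model_atom (M n)) i j :
  sabs (sofR k (Y (z l)) * u i (z l) - sofR k (rho (Y (z l))) * u j (z l)) <=
  sabs (sofR k (model_mult l) * model_coord i l - model_coord j l).
Proof.
rewrite Y_z !u_z; set a := model_mult l.
have rhoE : rho (bounded_transform a) = (1 + `|a|)^-1.
  by rewrite /rho normr_bounded_transform subKr.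
rewrite rhoE /bounded_transform (mulrC a) rmorphM /= -mulrA -mulrBr.
rewrite sabsM sabs_sofR.
rewrite ler_piMl ?sabs_ge0// ger0_norm ?invr_ge0 ?addr_ge0//.
by rewrite invf_le1 ?lerDl// ltr_pwDl.
Qed.

Theorem limit_model : exists (v : nat -> T -> K^o) (y : T -> R),
  [/\ (forall j, measurable_sfun (v j)) /\ measurable_fun setT y,
      forall w, `|y w| <= 1,
      forall s, sqint P (lincomb v s) = (rnorm (lincomb x s) ^+ 2)%:E,
      forall i j, (sqint P (fun w =>
          sofR k (y w) * v i w - sofR k (1 - `|y w|) * v j w)%R <=
        (rnorm (A (x i) - x j) ^+ 2)%:E)%E &
      forall n, (\int[P]_w (cutoff_square n (y w))%:E <= 1)%E].
Proof.
have [X [U [PU oU z_cvg]]] := law_limit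
  (fun n => @model_weight_ge0 _ _ _ _ _ _ (M n))
  (fun n => model_weight_sum (M n)) t_unif
  z (@cube_compact R V) (@cube_hausdorff R V).
exists (fun j => u j \o X), (Y \o X); split.
- split=> [j|]; last exact: (law_cvg_measurable z_cvg).
  split; apply: (law_cvg_measurable z_cvg (F := _ \o u j)).
    exact: (continuousT_comp (@u_continuous j) (@sre_continuous R k)).
  exact: (continuousT_comp (@u_continuous j) (@sim_continuous R k)).
- by move=> w; exact: signed_coord_le1.
- move=> s.
  have -> : lincomb (fun j => u j \o X : T -> K^o) s = lincomb u s \o X.
    by apply/funext => w; rewrite /= !lincombE.
  apply: (law_cvg_eq z_cvg (F := fun c => sabs (lincomb u s c) ^+ 2)).
    exact/continuous_sabs_sqr/continuous_lincomb.
  apply: oU.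
  have near_s : \forall n \near \oo, all (fun p : K * nat => p.2 < n)%N s.
    elim: s => [|p s IH]; first exact: nearW.
    near=> n; apply/andP; split; near: n; [exact: nbhs_infty_gt|exact: IH].
  apply: filterS near_s => n sn; rewrite -(model_coord_isometry (M n) sn).
  apply: eq_bigr => l _; rewrite !lincombE; congr (_ * sabs _ ^+ 2).
  by apply: eq_bigr => p _; rewrite u_z.
- move=> i j; apply: (law_cvg_le z_cvg (F := fun c =>
    sabs (sofR k (Y c) * u i c - sofR k (rho (Y c)) * u j c) ^+ 2)).
    apply/continuous_sabs_sqr/continuous_sfunB.
      exact: (continuous_scaleR Y_continuous (@u_continuous i)).
    exact: (continuous_scaleR rho_continuous (@u_continuous j)).
  apply: oU; near=> n; have [ni nj] : (i < n)%N /\ (j < n)%N.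
    by split; near: n; exact: nbhs_infty_gt.
  apply: le_trans (model_mult_dist (M n) ni nj); apply: ler_sum => l _.
  by rewrite ler_wpM2l ?model_weight_ge0// ler_pXn2r ?nnegrE ?sabs_ge0 ?mult_dist.
- move=> n; apply: (law_cvg_le z_cvg (F := fun c => cutoff_square n (Y c))).
    exact: (continuousT_comp Y_continuous (@cutoff_square_continuous R n)).
  apply: nearW => N; apply: le_trans (model_mult_moment (M N)).
  apply: ler_sum => l _; rewrite ler_wpM2l ?model_weight_ge0// Y_z.
  rewrite -[in leRHS](bounded_transformK (model_mult l)).
  exact/cutoff_square_le/bounded_transform_lt1.
Unshelve. all: by end_near. Qed.

End limit_model.

(** * The isometry and the intertwining relation *)

Section dense_sequences.
Variables (R : realType) (k : scalar_kind).
Local Notation K := (scalars R k).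
Variable H : normedModType K.

Definition dense_sequence (x : nat -> H) :=
  forall y e, 0 < e -> exists i, rnorm (y - x i) < e.

Definition graph_dense_sequence (A : operator H) (x : nat -> H) :=
  forall y e, dom A y -> 0 < e ->
  exists i, rnorm (y - x i) < e /\ rnorm (A y - A (x i)) < e.

Lemma dense_rnorm (S : set H) y (e : R) : dense S -> 0 < e ->
  exists2 s, S s & rnorm (y - s) < e.
Proof.
move=> dS e0; have e0K : 0 < sofR k e by rewrite -(sofR0 R k) ltr_sofR.
have ball0 : ball y (sofR k e) !=set0 by exists y; exact: ballxx.
have [s [ys Ss]] := dS _ ball0 (ball_open y (sofR k e)).
by exists s => //; move: ys; rewrite -ball_normE /= -sofR_rnorm ltr_sofR.
Qed.

Lemma graph_dense_sequence_dense (A : operator H) (x : nat -> H) :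
  densely_defined A -> graph_dense_sequence A x -> dense_sequence x.
Proof.
move=> A_dense x_graph y e e0; have e20 : 0 < e / 2 by rewrite divr_gt0.
have [s Ds ys] := dense_rnorm y A_dense e20.
have [i [si _]] := x_graph s _ Ds e20; exists i.
by rewrite [e]splitr (le_lt_trans (rnorm_distD s _ _))// ltrD.
Qed.

(* The graph of [A] is a subspace of the separable metric space [H * H]. *)
Lemma graph_dense_sequence_ex (A : operator H) : separable_space H ->
  exists2 x : nat -> H, forall i, dom A (x i) & graph_dense_sequence A x.
Proof.
move=> [S /countable_injP[f f_inj] S_dense].
pose en n := xget 0 [set s | S s /\ f s = n].
have enP s : S s -> exists n, en n = s.
  move=> Ss; exists (f s); rewrite /en.
  case: xgetP => [s' _ [Ss' ff]|/(_ s)]; last by case.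
  by apply: f_inj; rewrite ?inE.
pose graph_ball i j n := [set y : H | dom A y /\
  rnorm (y - en i) < n.+1%:R^-1 /\ rnorm (A y - en j) < n.+1%:R^-1].
pose x m :=
  if unpickle m is Some (i, j, n) then xget 0 (graph_ball i j n) else 0.
exists x => [m|y e Dy e0].
  rewrite /x; case: (unpickle m) => [[[i j] n]|]; last exact: dom0.
  by case: xgetP => [y _ []//|_]; exact: dom0.
have [n ne] : exists n : nat, n.+1%:R^-1 < e / 2.
  exists (Num.truncn (e / 2)^-1); rewrite invf_plt ?posrE ?divr_gt0//.
  exact: truncnS_gt.
have n0 : 0 < n.+1%:R^-1 :> R by rewrite invr_gt0.
have [_ /enP[i <-] ys] := dense_rnorm y S_dense n0.
have [_ /enP[j <-] Ays] := dense_rnorm (A y) S_dense n0.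
exists (pickle (i, j, n)); rewrite /x pickleK.
case: xgetP => [y' _ [_ [y'i Ay'j]]|/(_ y)]; last by case.
have close (u v w : H) : rnorm (u - w) < n.+1%:R^-1 ->
    rnorm (v - w) < n.+1%:R^-1 -> rnorm (u - v) < e.
  move=> uw vw; rewrite [e]splitr (le_lt_trans (rnorm_distD w _ _))//.
  by rewrite ltrD ?(lt_trans _ ne)// rnorm_distC.
by split; [exact: close ys y'i|exact: close Ays Ay'j].
Qed.

End dense_sequences.

Section isometric_extension.
Context (R : realType) (k : scalar_kind) (d : measure_display).
Context (T : measurableType d).
Variable mu : {measure set T -> \bar R}.
Local Notation K := (scalars R k).
Local Notation L := (L2 k mu).
Variables (H : normedModType K) (x : nat -> H) (F : nat -> L).
Hypothesis x_dense : dense_sequence x.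
Hypothesis F_isometry : forall s, rnorm (lincomb F s) = rnorm (lincomb x s).

Let affine_isometry a i j n :
  rnorm (a *: F i + F j - F n) = rnorm (a *: x i + x j - x n).
Proof.
have := F_isometry [:: (a, i); (1, j); (-1, n)].
by rewrite /lincomb !big_cons !big_nil /= !addr0 !scale1r !scaleN1r !addrA.
Qed.

Let dist_isometry i j : rnorm (F i - F j) = rnorm (x i - x j).
Proof. by have := affine_isometry 0 i i j; rewrite !scale0r !add0r. Qed.

Let approx (y : H) (G : L) := forall e, 0 < e ->
  exists i, rnorm (y - x i) < e /\ rnorm (G - F i) < e.

Let approx_ex y : exists G, approx y G.
Proof.
have quarter_gt0 r : 0 < 4^-1 ^+ r :> R by rewrite exprn_gt0// invr_gt0.
have /choice[j jP] r : exists i, rnorm (y - x i) < 4^-1 ^+ r / 2.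
  by apply: x_dense; rewrite divr_gt0.
have [r s rs|G GP] := @rapidly_cauchy_L2_limit _ k _ _ mu (F \o j).
  rewrite /= dist_isometry (le_trans (rnorm_distD y _ _))// rnorm_distC.
  have : 4^-1 ^+ s <= 4^-1 ^+ r :> R.
    by apply: ler_wiXn2l => //; rewrite ?invr_ge0// invf_le1// ler1n.
  by move: (jP r) (jP s) => /ltW + /ltW; lra.
exists G => e e0; have [r re] : exists r, 4^-1 ^+ r < e.
  have : 4^-1 ^+ r @[r --> \oo] --> (0 : R).
    by apply: cvg_expr; rewrite ger0_norm ?invr_ge0// invf_lt1// ltr1n.
  move=> /cvgrPdist_lt/(_ _ e0)[r _ /(_ r (leqnn r))] /=.
  by rewrite sub0r normrN gtr0_norm//; exists r.
exists (j r); split; last exact: le_lt_trans (GP r) re.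
rewrite (lt_trans (jP r))// (le_lt_trans _ re)// ler_pdivrMr//.
by rewrite ler_peMr ?ltW ?ltr1n.
Qed.

Let approx_rnorm a y z v G G' G'' : approx y G -> approx z G' -> approx v G'' ->
  rnorm (a *: G + G' - G'') = rnorm (a *: y + z - v).
Proof.
move=> yG zG vG; apply/eqP; rewrite -subr_eq0 -normr_le0.
set D := `|_|; pose c := 2 * (sabs a + 2).
have c0 : 0 < c by rewrite mulr_gt0// ltr_wpDl ?sabs_ge0.
suff D_small e : 0 < e -> D <= c * e.
  rewrite leNgt; apply/negP => D0; have /D_small : 0 < D / (2 * c).
    by rewrite divr_gt0// mulr_gt0.
  rewrite (_ : c * (D / (2 * c)) = D / 2); first lra.
  by field; rewrite gt_eqF.
move=> e0; have [i [yi Gi]] := yG e e0; have [j [zj Gj]] := zG e e0.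
have [n [vn Gn]] := vG e e0.
have dist_L := rnorm_distDB (a *: G) G' G'' (a *: F i) (F j) (F n).
have dist_H := rnorm_distDB (a *: y) z v (a *: x i) (x j) (x n).
move: dist_L dist_H; rewrite -!scalerBr rnorm_L2Z rnormZ affine_isometry.
rewrite /D /c.
move: (ler_wpM2l (sabs_ge0 a) (ltW yi)) (ler_wpM2l (sabs_ge0 a) (ltW Gi)).
rewrite !ler_norml => ? ? /andP[? ?] /andP[? ?]; apply/andP; split; lra.
Qed.

Theorem isometric_extension : exists U : {linear H -> L},
  (forall y, rnorm (U y) = rnorm y) /\ (forall j, U (x j) = F j).
Proof.
have /choice[U UP] := approx_ex.
have U_linear : linear U.
  move=> a y z; apply/eqP; rewrite eq_sym -subr_eq0; apply/eqP/rnorm_le0.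
  by rewrite (approx_rnorm a (UP y) (UP z) (UP _)) subrr rnorm0.
pose V : {linear H -> L} :=
  HB.pack U (GRing.isLinear.Build K H L *:%R U U_linear).
have approx_dist y z G G' :
    approx y G -> approx z G' -> rnorm (G - G') = rnorm (y - z).
  move=> yG zG; have := approx_rnorm 0 yG yG zG.
  by rewrite !scale0r !add0r.
exists V; split=> [y|j].
  have U0 : U 0 = 0 := linear0 V.
  by have := approx_dist _ _ _ _ (UP y) (UP 0); rewrite U0 !subr0.
apply/eqP; rewrite -subr_eq0; apply/eqP/rnorm_le0.
rewrite (approx_dist _ _ _ _ (UP (x j)) (_ : approx (x j) (F j))) ?subrr ?rnorm0//.
by move=> e e0; exists j; rewrite !subrr !rnorm0.
Qed.

End isometric_extension.

Section intertwining.
Context (R : realType) (k : scalar_kind) (d : measure_display).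
Context (T : measurableType d).
Variable mu : {measure set T -> \bar R}.
Local Notation K := (scalars R k).
Local Notation L := (L2 k mu).
Variables (H : normedModType K) (A : operator H) (x : nat -> H).
Hypotheses (x_dense : dense_sequence x) (x_graph : graph_dense_sequence A x).
Variables (U : {linear H -> L}) (y rho : {mfun T >-> R}).
Hypothesis U_isometry : forall z, rnorm (U z) = rnorm z.
Hypotheses (y1 : forall w, `|y w| <= 1) (rho1 : forall w, `|rho w| <= 1).
Hypothesis mulop_dist : forall i j,
  rnorm (mulop k mu y (U (x i)) - mulop k mu rho (U (x j))) <=
  rnorm (A (x i) - x j).

Lemma bounded_intertwining z :
  dom A z -> mulop k mu y (U z) = mulop k mu rho (U (A z)).
Proof.
move=> Dz; apply/eqP; rewrite -subr_eq0; apply/eqP/rnorm_le0.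
apply/ler_addgt0Pl => e e0; rewrite addr0.
have e40 : 0 < e / 4 by rewrite divr_gt0.
have [i [zi Azi]] := x_graph Dz e40; have [j Azj] := x_dense (A z) e40.
have contraction (m : {mfun T >-> R}) u v : (forall w, `|m w| <= 1) ->
    rnorm (mulop k mu m (U u) - mulop k mu m (U v)) <= rnorm (u - v).
  move=> m1; rewrite -opB; [|exact: dom_mulop_contraction..].
  by rewrite -linearB -(U_isometry (u - v)); exact: rnorm_mulop_le.
apply: (le_trans (rnorm_distD (mulop k mu y (U (x i))) _ _)).
apply: (le_trans (lerD (lexx _) (rnorm_distD (mulop k mu rho (U (x j))) _ _))).
have := contraction y z (x i) y1; have := contraction rho (x j) (A z) rho1.
have := mulop_dist i j; have := rnorm_distD (A z) (A (x i)) (x j).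
rewrite (rnorm_distC (A (x i)) (A z)) (rnorm_distC (x j) (A z)); lra.
Qed.

End intertwining.

Section realization.
Context (R : realType) (k : scalar_kind) (d : measure_display).
Context (T : measurableType d).
Variable mu : {measure set T -> \bar R}.
Local Notation K := (scalars R k).
Local Notation L := (L2 k mu).

Lemma sqr_integral_Lfun (m : T -> R) : measurable_fun setT m ->
  (\int[mu]_w (m w ^+ 2)%:E < +oo)%E -> m \in Lfun mu 2%:E.
Proof.
move=> mm m2; rewrite inE; apply/andP; split; rewrite inE//= /finite_norm ltey.
apply: contraTN m2 => /eqP m_infty; rewrite -leNgt leye_eq.
rewrite -(poweRyr (lt0r_neq0 (ltr0Sn R 1))) -m_infty poweR_Lnorm//.
apply/eqP/eq_integral => w _ /=.
by rewrite powR_mulrn// real_normK ?num_real.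
Qed.

Variables (H : normedModType K) (A : operator H) (x : nat -> H).
Hypotheses (x_dense : dense_sequence x) (x_graph : graph_dense_sequence A x).
Variables (v : nat -> T -> K^o) (y : T -> R).
Hypotheses (mv : forall j, measurable_sfun (v j)) (my : measurable_fun setT y).
Hypothesis y1 : forall w, `|y w| <= 1.
Hypothesis v_isometry :
  forall s, sqint mu (lincomb v s) = (rnorm (lincomb x s) ^+ 2)%:E.
Hypothesis v_dist : forall i j, (sqint mu (fun w =>
    sofR k (y w) * v i w - sofR k (1 - `|y w|) * v j w)%R <=
  (rnorm (A (x i) - x j) ^+ 2)%:E)%E.
Hypothesis y_moment :
  forall n, (\int[mu]_w (cutoff_square n (y w))%:E <= 1)%E.

Let rho w : R := 1 - `|y w|.

Let rho_ge0 w : 0 <= rho w. Proof. by rewrite subr_ge0. Qed.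

Let rho1 w : `|rho w| <= 1.
Proof. by rewrite ger0_norm ?rho_ge0// gerBl. Qed.

Let mrho : measurable_fun setT rho.
Proof. by apply: measurable_funB => //; exact: measurableT_comp. Qed.

Let y_mfun : {mfun T >-> R} := mfun_Sub (mem_set my).

Let rho_mfun : {mfun T >-> R} := mfun_Sub (mem_set mrho).

Let v_L2 j : v j \in L2fun k mu.
Proof.
apply: L2fun_sqint => //; have := v_isometry [:: (1, j)].
by rewrite /lincomb !big_seq1 /= !scale1r => ->; rewrite ltry.
Qed.

Let class_isometry s :
  rnorm (lincomb (fun j => L2_class mu (v j)) s) = rnorm (lincomb x s).
Proof.
have Lvs : lincomb v s \in L2fun k mu by apply: rpred_sum => p _; exact: rpredZ.
apply: (@pexpIrn _ 2) => //; rewrite ?nnegrE ?rnorm_ge0//; apply: EFin_inj.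
by rewrite -v_isometry -rnorm_L2_class// (L2_class_lincomb _ v_L2).
Qed.

Let class_dist i j :
  rnorm (mulop k mu y_mfun (L2_class mu (v i)) -
         mulop k mu rho_mfun (L2_class mu (v j))) <= rnorm (A (x i) - x j).
Proof.
have Lyv : smul y_mfun (v i) \in L2fun k mu by exact: smul_L2fun.
have Lrv : smul rho_mfun (v j) \in L2fun k mu by exact: smul_L2fun.
rewrite (mulop_L2_class (v_L2 i) Lyv) (mulop_L2_class (v_L2 j) Lrv) -L2_classB//.
rewrite -(@ler_pXn2r _ 2) ?nnegrE ?rnorm_ge0//.
by rewrite -lee_fin rnorm_L2_class ?rpredB//; exact: v_dist.
Qed.

Theorem multiplication_realization :
  exists (U : {linear H -> L}) (m : LfunType mu (lee1n 2)),
    (forall z, rnorm (U z) = rnorm z) /\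
    (forall z, dom A z ->
       dom (mulop k mu m) (U z) /\ U (A z) = mulop k mu m (U z)).
Proof.
have [U [U_isometry U_x]] := isometric_extension x_dense class_isometry.
have [y_lt1 m2] := cutoff_square_moment my y1 y_moment.
have Lm : (fun w => unbounded_transform (y w)) \in Lfun mu 2%:E.
  apply: sqr_integral_Lfun; first exact: measurable_unbounded_transform.
  by rewrite (le_lt_trans m2)// ltry.
exists U, (Lfun_Sub (lee1n 2) Lm); split=> // z Dz.
have U_dist i j : rnorm (mulop k mu y_mfun (U (x i)) -
    mulop k mu rho_mfun (U (x j))) <= rnorm (A (x i) - x j).
  by rewrite !U_x; exact: class_dist.
have yU_rhoUA : mulop k mu y_mfun (U z) = mulop k mu rho_mfun (U (A z)).
  exact: bounded_intertwining U_dist _ Dz.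
have [] // := mulop_divide (m := Lfun_Sub (lee1n 2) Lm) _ _ _ yU_rhoUA.
- apply: filterS y_lt1 => w yw; have rho0 : rho w != 0 by rewrite gt_eqF ?subr_gt0.
  by split=> //; exact: divfK.
- exact: dom_mulop_contraction.
- exact: dom_mulop_contraction.
Qed.

End realization.

Theorem theorem1p1 (R : realType) (k : scalar_kind)
    (H : completeNormedModType (scalars R k)) (ip : {dot H for @sconj R k})
    (ip_norm : forall x : H, `|x| ^+ 2 = ip x x)
    (H_separable : separable_space H)
    (A : operator H)
    (A_dense : densely_defined A)
    (A_symmetric : symmetric_operator ip A) :
  exists (Omega : pointedMetricType R)
         (mu : probability (borelType Omega) R)
         (U : {linear H -> L2 k mu})
         (m : LfunType mu (lee1n 2)),
    [/\ compact [set: Omega],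
        forall x : H, `|U x| = `|x| &
        forall x : H, dom A x ->
          dom (mulop k mu m) (U x) /\ U (A x) = mulop k mu m (U x)].
Proof.
have [x Dx x_graph] := graph_dense_sequence_ex A H_separable.
have x_dense := graph_dense_sequence_dense A_dense x_graph.
pose M n := unsquash (finite_model_ex n ip_norm A_symmetric Dx).
have [v [y [[mv my] y1 v_isometry y_dist y_moment]]] :=
  limit_model M (@unit_coord_uniform R).
have [U [m [U_isometry U_m]]] := multiplication_realization
  x_dense x_graph mv my y1 v_isometry y_dist y_moment.
exists (unit_itv R), (unit_measure R), U, m; split.
- exact: unit_itv_compact.
- by move=> z; rewrite -!sofR_rnorm U_isometry.
- by move=> z /U_m.
Qed.
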